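(* For every $\gamma>0$ there is a constant $n_0>0$ (depending only on $\gamma$) such that for all integers $n\geq n_0$ and all odd prime powers $q$, independent uniformly random $A,B\in\mathfrak{sl}_n(\mathbf{F}_q)$ generate the Lie algebra $\mathfrak{sl}_n(\mathbf{F}_q)$ with probability at least $1-n^{-\gamma}$.
   Context: $\mathbf{F}_q$ is the finite field with $q$ elements. $\mathfrak{sl}_n(\mathbf{F}_q)$ is the Lie algebra of $n\times n$ trace zero matrices over $\mathbf{F}_q$ with bracket $[X,Y]=XY-YX$. Elements generate a Lie algebra over $\mathbf{F}_q$ if the smallest $\mathbf{F}_q$-Lie subalgebra containing them is the whole algebra. *)

(* Defs.v *)
From HB Require Import structures.
From mathcomp Require Import all_boot all_order all_algebra.
From mathcomp Require Import reals exp.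

Set Implicit Arguments.
Unset Strict Implicit.
Unset Printing Implicit Defensive.

Import Order.TTheory GRing.Theory Num.Theory.

Local Open Scope ring_scope.

Definition lie_bracket (F : finFieldType) (n : nat) (X Y : 'M[F]_n) : 'M[F]_n :=
  X *m Y - Y *m X.

Definition lie_subalgebra (F : finFieldType) (n : nat) (L : {set 'M[F]_n}) :
    bool :=
  [&& 0 \in L,
      [forall a : F, forall X in L, forall Y in L, a *: X + Y \in L]
    & [forall X in L, forall Y in L, lie_bracket X Y \in L]].

Definition sl (F : finFieldType) (n : nat) : {set 'M[F]_n} :=
  [set X | \tr X == 0].

(* The intersection is taken over the Lie subalgebras of all n x n matrices;
   since sl F n is one of them, for S \subset sl F n this is the smallest Lie
   subalgebra of sl F n containing S. *)
Definition lie_span (F : finFieldType) (n : nat) (S : {set 'M[F]_n}) :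
    {set 'M[F]_n} :=
  \bigcap_(L : {set 'M[F]_n} | lie_subalgebra L && (S \subset L)) L.

Definition uniform_prob (R : realType) (T : finType) (Omega : {set T})
    (E : pred T) : R :=
  #|[set w in Omega | E w]|%:R / #|Omega|%:R.

(* Two independent uniform elements of sl F n are a uniform element of the
   product set. *)
Definition prob_generate_sl (R : realType) (F : finFieldType) (n : nat) : R :=
  uniform_prob R (setX (sl F n) (sl F n))
    (fun p => lie_span [set p.1; p.2] == sl F n).

(* Main.v *)
(* Let K be an algebraic closure of F, q = #|F|, and L the Lie algebra generated by
   A and B.  Suppose A has an eigenvalue lam of large degree d over F, with simple
   conjugates lam_i = lam ^ (q ^ i), such that lam - lam ^ q differs from all the
   other differences of eigenvalues of A.  A polynomial in ad A then projects B onto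
   the line of the rank one matrix v_0 u_1 (v_i and u_i being the eigenvectors for
   lam_i), which lies in K L unless u_0 B v_1 = 0.  By Frobenius v_i u_(i+1) is in
   K L for all i, hence so is sl of the span of the v_i, and K L = sl_n(K) as soon
   as the rational vectors sum v_i and sum u_i generate F^n under A, B and under
   their transposes.  The latter holds with high probability because a random
   matrix has a Krylov space of small dimension with exponentially small
   probability only.

   To see that A is as required, fix a vector w with Krylov space of dimension k.
   Adding to A a rank one matrix phi (w c(A)), where phi is dual to the last Krylov
   vector, translates the factor f of degree k of the characteristic polynomial by
   c.  So f is uniform among monic polynomials of degree k with a prescribed
   subleading coefficient.  Such an f has an irreducible factor of degree about
   sqrt n except with probability n^(-gamma) (the only bound that is not
   exponentially small), and for most choices of that factor the difference
   lam - lam ^ q is isolated. *)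

Require Import Defs.
From HB Require Import structures.
From mathcomp Require Import all_boot all_order all_algebra all_solvable all_field.
From mathcomp Require Import reals exp boolp.
From mathcomp Require Import zify.

Set Implicit Arguments.
Unset Strict Implicit.
Unset Printing Implicit Defensive.

Import Order.TTheory GRing.Theory Num.Theory.

Local Open Scope ring_scope.

(** * Frobenius and conjugate roots *)

(** The size sqrt n answers two demands. It must be small against [n]: the proportion of polynomials
    of degree about [n] all of whose prime power divisors have degree at most [J] is only bounded by
    about [(J / n) ^ r], with [r] fixed but arbitrary. It must be large because the other losses at
    this stage are compensated by powers [q ^ (- c)] with [c] proportional to it, for all [q] at
    once and thus already for [q = 3]. The characteristic may divide [n], so scalar matrices cannot
    be split off: membership in the Lie algebra is followed modulo a single rank one idempotent [e],
    whose coefficient turns out to be a trace. Random changes of [A] and [B] have to stay traceless,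
    which shapes the translations used for counting. Oddness of [q] is indispensable for the
    isolated difference: in characteristic 2, [lam - lam ^ q] is also [lam ^ q - lam]. Probabilities
    appear as inequalities between cardinals with the denominators multiplied out, [M] standing for
    the inverse of a probability. *)

Section Frobenius.
Variables (F : finFieldType) (K : fieldType) (fK : {rmorphism F -> K}).

(* The morphism [fK] only serves to know that [K] has the characteristic of [F]. *)
Definition frob of {rmorphism F -> K} := fun x : K => x ^+ #|F|.
Local Notation fr := (frob fK).

Lemma frob_zmod : zmod_morphism fr.
Proof.
move=> x y; rewrite /frob.
have [p p_pr pF] := finPcharP F.
have pK := rmorph_pchar fK pF.
have pnat : [pchar K].-nat #|F|.
  have := pprimeChar_pgroup pF; rewrite /pgroup cardsT.
  by apply: sub_in_pnat => r _; rewrite inE => /eqP ->.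
by rewrite exprDn_pchar // exprNn_pchar.
Qed.

Lemma frob_monoid : monoid_morphism fr.
Proof. by split=> [|x y]; rewrite /frob ?expr1n ?exprMn. Qed.

HB.instance Definition _ := GRing.isZmodMorphism.Build K K fr frob_zmod.
HB.instance Definition _ := GRing.isMonoidMorphism.Build K K fr frob_monoid.

Lemma frobE x : fr x = x ^+ #|F|. Proof. by []. Qed.

Lemma iter_frobE i x : iter i fr x = x ^+ (#|F| ^ i).
Proof.
elim: i => [|i IH] /=; first by rewrite expn0 expr1.
by rewrite IH /frob -exprM expnSr.
Qed.

Lemma frob_inj : injective fr.
Proof. exact: fmorph_inj. Qed.

Lemma iter_inj_frob i : injective (iter i fr).
Proof. by elim: i => //= i IH x y /frob_inj/IH. Qed.

Lemma frob_base a : fr (fK a) = fK a.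
Proof. by rewrite /frob -rmorphXn expf_card. Qed.

Lemma frob_fixed x : fr x = x -> exists a, x = fK a.
Proof.
move=> xq.
have : root (map_poly fK ('X^#|F| - 'X)) x.
  by rewrite rmorphB /= map_polyXn map_polyX rootE !hornerE -frobE xq subrr.
rewrite finField_genPoly rmorph_prod /=.
have -> : \prod_i map_poly fK ('X - i%:P) = \prod_(y <- [seq fK a | a <- index_enum F]) ('X - y%:P).
  by rewrite big_map; apply: eq_bigr => i _; rewrite map_polyXsubC.
by rewrite root_prod_XsubC => /mapP[a _ ->]; exists a.
Qed.

Lemma horner_iter_frob i (c : {poly F}) x :
  (map_poly fK c).[iter i fr x] = iter i fr (map_poly fK c).[x].
Proof.
elim: i => //= i <-; rewrite -[in RHS]horner_map; congr (_.[_]).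
by rewrite -map_poly_comp; apply: eq_map_poly => a /=; rewrite frob_base.
Qed.

Lemma root_iter_frob i (c : {poly F}) x :
  root (map_poly fK c) x -> root (map_poly fK c) (iter i fr x).
Proof.
rewrite !rootE horner_iter_frob => /eqP ->.
by elim: i => //= i /eqP ->; rewrite rmorph0.
Qed.

Section Irreducible.
Variables (P : {poly F}) (lam : K).
Hypotheses (irrP : irreducible_poly P) (monP : P \is monic).
Hypothesis root_lam : root (map_poly fK P) lam.

Lemma irreducible_dvdp (c : {poly F}) : root (map_poly fK c) lam -> P %| c.
Proof.
move=> rc; apply: contraLR rc => ndv.
have := irreducible_poly_coprime c irrP; rewrite ndv.
by rewrite -(coprimep_map fK) => /coprimep_root /(_ root_lam).
Qed.

Lemma irreducible_lin_indep (c c' : {poly F}) :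
  (size c < size P)%N -> (size c' < size P)%N ->
  (map_poly fK c).[lam] = (map_poly fK c').[lam] -> c = c'.
Proof.
move=> sc sc' cc'; apply/eqP; rewrite -subr_eq0; apply: contraTT isT => nz.
have dv : P %| c - c'.
  by apply: irreducible_dvdp; rewrite rmorphB /= rootE hornerD hornerN cc' subrr.
have := dvdp_leq nz dv; rewrite leqNgt => /negP[].
by rewrite (leq_ltn_trans (size_polyD _ _)) // gtn_max size_polyN sc sc'.
Qed.

(** The class of ['X] lies in the field [{poly %/ P}], all of whose elements are fixed by the power
    given by its cardinal. *)
Lemma irreducible_dvd_Xq : P %| 'X^(#|F| ^ (size P).-1) - 'X.
Proof.
have mi : monic_irreducible_poly P by split.
have := expf_card ((in_qpoly P 'X : {poly %/ P}) : {poly %/ P with mi}).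
rewrite card_qfpoly => /eqP E.
have : in_qpoly P ('X^(#|F| ^ (size P).-1) - 'X) = 0.
  rewrite rmorphB rmorphXn /=; apply/eqP; rewrite subr_eq0; exact: E.
move/(congr1 val) => /=; rewrite (mk_monicE mi) => rm0.
by rewrite /dvdp Pdiv.IdomainMonic.modpE // rm0.
Qed.

Lemma iter_frob_root : iter (size P).-1 fr lam = lam.
Proof.
have /dvdpP[c E] := irreducible_dvd_Xq.
have : (map_poly fK ('X^(#|F| ^ (size P).-1) - 'X)).[lam] = 0.
  by rewrite E rmorphM /= hornerM (rootP root_lam) mulr0.
rewrite rmorphB /= map_polyXn map_polyX !hornerE -iter_frobE => /eqP.
by rewrite subr_eq0 => /eqP.
Qed.

(** If [iter i fr] fixed [lam], it would fix the [#|F| ^ (size P).-1] distinct values at [lam] of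
    polynomials of smaller degree than [P]; but its fixed points are the roots of a polynomial of
    degree [#|F| ^ i]. *)
Lemma iter_frob_neq i : (0 < i < (size P).-1)%N -> iter i fr lam != lam.
Proof.
move=> /andP[i0 id]; apply/eqP => Ei.
pose s := [seq (map_poly fK (val c)).[lam] | c <- enum {poly_(size P).-1 F}].
have szP : (0 < size P)%N by case: (size P) id.
have us : uniq s.
  rewrite map_inj_uniq ?enum_uniq // => c c' E; apply: val_inj.
  by apply: irreducible_lin_indep => //; apply: leq_ltn_trans (size_npoly _) _;
    rewrite ltn_predL.
have q1 := finNzRing_gt1 F.
have qi1 : (1 < #|F| ^ i)%N by rewrite -[1%N in ltnLHS](expn0 #|F|) ltn_exp2l.
have szX : size ('X^(#|F| ^ i) - 'X : {poly K}) = (#|F| ^ i).+1.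
  rewrite size_polyDl ?size_polyXn // size_polyN size_polyX ltnS.
  exact: qi1.
have := @max_poly_roots K ('X^(#|F| ^ i) - 'X) s.
rewrite -size_poly_eq0 szX => /(_ isT) H.
have : (size s < (#|F| ^ i).+1)%N.
  apply: H => //; apply/allP => _ /mapP[c _ ->].
  by rewrite rootE !hornerE -iter_frobE -horner_iter_frob Ei subrr.
by rewrite size_map -cardE card_npoly ltnS leqNgt ltn_exp2l // id.
Qed.

Lemma iter_frob_inj i j : (i < (size P).-1)%N -> (j < (size P).-1)%N ->
  iter i fr lam = iter j fr lam -> i = j.
Proof.
wlog ij : i j / (i <= j)%N.
  by move=> H i_ j_ E; case: (leqP i j) => [/H|/ltnW/H] ->.
move=> id jd; rewrite -{1}(subnKC ij) iterD => /(iter_inj_frob) E.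
case: (posnP (j - i)) => [/eqP|ji]; first by rewrite subn_eq0 => ji; apply/eqP; rewrite eqn_leq ij.
have := @iter_frob_neq (j - i); rewrite ji /= => /(_ (leq_ltn_trans (leq_subr _ _) jd)).
by rewrite -E eqxx.
Qed.

Lemma irreducible_prod_frob :
  map_poly fK P = \prod_(r <- [seq iter i fr lam | i <- iota 0 (size P).-1]) ('X - r%:P).
Proof.
have szP : (0 < size P)%N by rewrite lt0n size_poly_eq0 monic_neq0.
have := @all_roots_prod_XsubC K (map_poly fK P) [seq iter i fr lam | i <- iota 0 (size P).-1].
rewrite size_map_poly size_map size_iota prednK // (eqP (monic_map fK monP)) scale1r.
apply=> //.
- by apply/allP => _ /mapP[i _ ->]; apply: root_iter_frob.
- rewrite uniq_rootsE map_inj_in_uniq ?iota_uniq // => i j.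
  by rewrite !mem_iota; apply: iter_frob_inj.
Qed.

End Irreducible.
End Frobenius.

(** * Rank one perturbations *)

(* The bordered matrix (M, -u; v, 1) is reduced by column operations on one side
   and, after multiplication by adj M, by row operations on the other. *)
Lemma det_rank1_update (R : idomainType) n (M : 'M[R]_n) (u : 'cV_n) (v : 'rV_n) :
  \det M != 0 -> \det (M + u *m v) = \det M + (v *m \adj M *m u) 0 0.
Proof.
move=> nzM.
have e1 : block_mx M (- u) v 1%:M *m block_mx 1%:M 0 (- v) 1%:M
     = block_mx (M + u *m v) (- u) 0 1%:M.
  by rewrite mulmx_block !mulmx1 !mulmx0 !mul1mx !add0r mulNmx mulmxN opprK
    addrN.
have := congr1 determinant e1.
rewrite det_mulmx det_lblock !det1 !mulr1 (det_ublock (M + _)) det1 mulr1 => <-.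
have e2 : block_mx 1%:M 0 (- v) (\det M)%:M *m
    (block_mx (\adj M) 0 0 1%:M *m block_mx M (- u) v 1%:M)
     = block_mx (\det M)%:M (- (\adj M *m u)) 0 (\det M + (v *m \adj M *m u) 0 0)%:M.
  rewrite !mulmx_block !mul0mx !mul1mx !add0r !addr0 !mul_adj_mx.
  rewrite !mulmxN !mulNmx mul_mx_scalar mul_scalar_mx opprK addNr raddfD /=.
  by rewrite mulmx1 -mx11_scalar mulmxA addrC.
have := congr1 determinant e2.
rewrite !det_mulmx det_lblock !det_ublock !det1 !mulr1 !mul1r.
rewrite !det_scalar expr1 => e3.
have e4 : \det (\adj M) * \det M = \det M ^+ n by rewrite -det_mulmx mul_adj_mx det_scalar.
have : \det M ^+ n != 0 by rewrite expf_neq0.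
move=> /mulfI; apply.
by rewrite -[X in _ = _ * X]expr1 -e3 -{1}e4 -mulrA mulrCA.
Qed.

(** The numerator of the resolvent [w (X - A)^-1 phi] over the denominator [char_poly A]. *)
Definition resolvent_form (F : fieldType) n (A : 'M[F]_n) (phi : 'cV_n) (w : 'rV_n) : {poly F} :=
  (map_mx polyC w *m \adj (char_poly_mx A) *m map_mx polyC phi) 0 0.

Lemma char_poly_rank1_update (F : fieldType) n (A : 'M[F]_n) (phi : 'cV_n) (w : 'rV_n) :
  char_poly (A + phi *m w) = char_poly A - resolvent_form A phi w.
Proof.
have e : char_poly_mx (A + phi *m w) =
   char_poly_mx A + (map_mx polyC phi) *m (- map_mx polyC w).
  by rewrite /char_poly_mx map_mxD map_mxM opprD addrA mulmxN.
rewrite /char_poly e det_rank1_update; last first.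
  exact: monic_neq0 (char_poly_monic A).
by rewrite !mulNmx mxE.
Qed.

Lemma resolvent_formD (F : fieldType) n (A : 'M[F]_n) (phi : 'cV_n) (w w' : 'rV_n) :
  resolvent_form A phi (w + w') = resolvent_form A phi w + resolvent_form A phi w'.
Proof. by rewrite /resolvent_form map_mxD !mulmxDl mxE. Qed.

Lemma resolvent_formZ (F : fieldType) n (A : 'M[F]_n) (phi : 'cV_n) a (w : 'rV_n) :
  resolvent_form A phi (a *: w) = a%:P * resolvent_form A phi w.
Proof. by rewrite /resolvent_form map_mxZ -!scalemxAl mxE. Qed.

Lemma resolvent_form_sum (F : fieldType) n (A : 'M[F]_n) (phi : 'cV_n)
   I (r : seq I) (w : I -> 'rV_n) :
  resolvent_form A phi (\sum_(i <- r) w i) = \sum_(i <- r) resolvent_form A phi (w i).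
Proof.
apply: (big_morph _ (resolvent_formD A phi)).
by rewrite -(scale0r 0) resolvent_formZ mul0r.
Qed.

(** Since [w A = X w - w (X - A)], the adjugate cancels against the last factor up to [char_poly A].
    Iteration computes the numerators along a Krylov sequence. *)
Lemma resolvent_form_mul (F : fieldType) n (A : 'M[F]_n) (phi : 'cV_n) (w : 'rV_n) :
  resolvent_form A phi (w *m A) =
  'X * resolvent_form A phi w - char_poly A * ((w *m phi) 0 0)%:P.
Proof.
rewrite /resolvent_form.
have -> : map_mx polyC (w *m A) = 'X *: map_mx polyC w - map_mx polyC w *m char_poly_mx A.
  rewrite /char_poly_mx mulmxBr mul_mx_scalar opprB addrCA subrr addr0.
  by rewrite map_mxM.
rewrite mulmxBl -(mulmxA _ (char_poly_mx A)) mul_mx_adj mul_mx_scalar mulmxBl -!scalemxAl.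
by rewrite -map_mxM !mxE /char_poly.
Qed.

(* Adding [e *m u] moves the eigenvalue [a] to [a + 1], but [y] keeps [a]. *)
Lemma simple_eigenspace (F : fieldType) n (A : 'M[F]_n) (a : F) (g : {poly F}) (u y : 'rV_n) :
  char_poly A = ('X - a%:P) * g -> ~~ root g a ->
  u != 0 -> u *m A = a *: u -> y *m A = a *: y -> exists c, y = c *: u.
Proof.
move=> chiA ga nzu uA yA; apply/sub_rVP; apply: contraT => nyu.
have [j nzj] : exists j, u 0 j != 0 by apply/rV0Pn.
pose y' := y - (y 0 j / u 0 j) *: u.
have y'A : y' *m A = a *: y'.
  by rewrite mulmxBl yA -scalemxAl uA scalerBr !scalerA [_ * a]mulrC.
have nzy' : y' != 0.
  apply: contra nyu; rewrite subr_eq0 => /eqP ->; exact: scalemx_sub.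
pose e : 'cV[F]_n := (u 0 j)^-1 *: delta_mx j 0.
have ej (w : 'rV_n) : w *m e = (w 0 j / u 0 j)%:M.
  rewrite -scalemxAr -colE; apply/rowP=> i; rewrite ord1 !mxE mulr1n mulrC //.
have y'e : y' *m e = 0.
  by rewrite ej !mxE divfK // subrr mul0r raddf0.
have rf : resolvent_form A e u = g.
  have := resolvent_form_mul A e u; rewrite uA resolvent_formZ ej mxE eqxx mulr1n divff //.
  rewrite mulr1 chiA => /eqP; rewrite eq_sym subr_eq addrC -subr_eq -mulrBl => /eqP.
  by apply: mulfI; rewrite polyXsubC_eq0.
have chi' : char_poly (A + e *m u) = ('X - (a + 1)%:P) * g.
  by rewrite char_poly_rank1_update rf chiA polyCD polyC1 opprD addrA [RHS]mulrBl mul1r.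
have ev : eigenvalue (A + e *m u) a.
  apply/eigenvalueP; exists y' => //.
  by rewrite mulmxDr y'A mulmxA y'e mul0mx addr0.
move: ev; rewrite eigenvalue_root_char chi' rootM (negPf ga) orbF root_XsubC.
by rewrite -subr_eq0 opprD addNKr oppr_eq0 oner_eq0.
Qed.

(** * Lie algebras containing a block of type sl *)

Definition commmx (R : pzRingType) n (X Y : 'M[R]_n) : 'M[R]_n := X *m Y - Y *m X.

Definition pairing (R : pzSemiRingType) n (f : 'rV[R]_n) (x : 'cV[R]_n) : R :=
  (f *m x) 0 0.

(** A predicate instead of a finite set, because it serves for a span over a field [K] that may be
    infinite. *)
Record lie_closed (K : fieldType) n (L : 'M[K]_n -> Prop) : Prop := LieClosed {
  lie_closedD : forall X Y, L X -> L Y -> L (X + Y);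
  lie_closedZ : forall a X, L X -> L (a *: X);
  lie_closed_comm : forall X Y, L X -> L Y -> L (commmx X Y) }.

Section Pairing.
Variables (K : fieldType) (n : nat).
Implicit Types (f g : 'rV[K]_n) (x y : 'cV[K]_n) (Z : 'M[K]_n).

Lemma pairingDr f x y : pairing f (x + y) = pairing f x + pairing f y.
Proof. by rewrite /pairing mulmxDr mxE. Qed.
Lemma pairingBr f x y : pairing f (x - y) = pairing f x - pairing f y.
Proof. by rewrite /pairing mulmxBr !mxE. Qed.
Lemma pairingZr a f x : pairing f (a *: x) = a * pairing f x.
Proof. by rewrite /pairing -scalemxAr mxE. Qed.
Lemma pairingZl a f x : pairing (a *: f) x = a * pairing f x.
Proof. by rewrite /pairing -scalemxAl mxE. Qed.
Lemma pairing_tr f x : pairing x^T f^T = pairing f x.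
Proof. by rewrite /pairing -trmx_mul mxE. Qed.

Lemma mul_rank1 f g x y : (x *m f) *m (y *m g) = pairing f y *: (x *m g).
Proof.
rewrite mulmxA -(mulmxA x f) [f *m y]mx11_scalar mul_mx_scalar.
by rewrite -scalemxAl.
Qed.

Lemma commmx_rank1 f g x y :
  commmx (x *m f) (y *m g) = pairing f y *: (x *m g) - pairing g x *: (y *m f).
Proof. by rewrite /commmx !mul_rank1. Qed.

Lemma commmx_rank1l Z f x : commmx Z (x *m f) = (Z *m x) *m f - x *m (f *m Z).
Proof. by rewrite /commmx !mulmxA. Qed.

Lemma commmxBl (X Y Z : 'M[K]_n) : commmx (X - Y) Z = commmx X Z - commmx Y Z.
Proof. by rewrite /commmx mulmxBl mulmxBr !opprB addrACA [RHS]addrACA; congr (_ + _); rewrite addrC. Qed.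

Lemma commmxZl a (X Z : 'M[K]_n) : commmx (a *: X) Z = a *: commmx X Z.
Proof. by rewrite /commmx -scalemxAl -scalemxAr scalerBr. Qed.

Lemma commmx_rank1_rank1 Z f g x y :
  commmx (commmx Z (x *m f)) (y *m g) =
  pairing f y *: (Z *m x *m g) - pairing g (Z *m x) *: (y *m f)
  - (pairing f (Z *m y) *: (x *m g) - pairing g x *: (y *m (f *m Z))).
Proof.
by rewrite (commmx_rank1l Z f x) commmxBl !commmx_rank1 /pairing !mulmxA.
Qed.
End Pairing.

Section Extend.
Variables (K : fieldType) (n : nat) (L : 'M[K]_n -> Prop) (I : eqType).
Variables (v : I -> 'cV[K]_n) (u : I -> 'rV[K]_n) (i0 : I).
Hypothesis lieL : lie_closed L.
Hypothesis dot_uv : forall i j, pairing (u i) (v j) = (i == j)%:R.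
Hypothesis L_vu : forall i j, i != j -> L (v i *m u j).
Hypothesis third : forall i j : I, exists2 k, k != i & k != j.

Let LD := lie_closedD lieL.
Let LZ := lie_closedZ lieL.
Let LC := lie_closed_comm lieL.

Let LB X Y : L X -> L Y -> L (X - Y).
Proof. by move=> LX LY; rewrite -scaleN1r; apply: LD => //; apply: LZ. Qed.

Let L0 : L 0.
Proof.
by have [j ji _] := third i0 i0; rewrite -(scale0r (v j *m u i0)); apply/LZ/L_vu.
Qed.

Let L_vu' i j : j != i -> L (v i *m u j).
Proof. by rewrite eq_sym; apply: L_vu. Qed.

Let L_diag i j : L (v i *m u i - v j *m u j).
Proof.
have [->|ij] := eqVneq i j; first by rewrite subrr.
have := LC (L_vu ij) (L_vu' ij).
by rewrite commmx_rank1 !dot_uv !eqxx !scale1r.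
Qed.

Let e := v i0 *m u i0.

(* Modulo [L] the matrices [v k *m u k] all coincide.  Unlike [x *m u k \in L],
   this condition on [x] holds for the [v i] themselves and is stable under [L]. *)
Definition almost_in (x : 'cV[K]_n) := forall k, L (x *m u k - pairing (u k) x *: e).

Lemma almost_in_v i : almost_in (v i).
Proof.
move=> k; rewrite dot_uv; have [->|ki] := eqVneq k i; first by rewrite scale1r; apply: L_diag.
by rewrite scale0r subr0; apply: L_vu; rewrite eq_sym.
Qed.

Lemma almost_inD x y : almost_in x -> almost_in y -> almost_in (x + y).
Proof.
move=> Tx Ty k; rewrite mulmxDl pairingDr scalerDl opprD addrACA.
exact: LD.
Qed.

Lemma almost_inZ a x : almost_in x -> almost_in (a *: x).
Proof.
by move=> Tx k; rewrite pairingZr -scalemxAl -scalerA -scalerBr; apply: LZ.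
Qed.

Let almost_inP x : (forall k, exists j, L (x *m u k - pairing (u k) x *: (v j *m u j))) ->
  almost_in x.
Proof.
move=> H k; have [j Lj] := H k.
have := LD Lj (LZ (pairing (u k) x) (L_diag j i0)).
by rewrite scalerBr addrA subrK.
Qed.

(** For distinct [i], [j], [k] the bracket [[[Z, v i u j], v j u k]] is [Z v i u k - pairing (u k)
    (Z v i) v j u j] up to a multiple of [v i u k], which is in [L]. *)
Let almost_in_mulv Z i : L Z -> almost_in (Z *m v i).
Proof.
move=> LZ'; apply: almost_inP.
have off k j : k != i -> j != i -> j != k ->
    L (Z *m v i *m u k - pairing (u k) (Z *m v i) *: (v j *m u j)).
  move=> ki ji jk; have ij : i != j by rewrite eq_sym.
  have := LC (LC LZ' (L_vu ij)) (L_vu jk).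
  rewrite commmx_rank1_rank1 !dot_uv (negPf ki) eqxx scale1r scale0r subr0.
  move/LD/(_ (LZ (pairing (u j) (Z *m v j)) (L_vu' ki))).
  by rewrite subrK.
move=> k; have [->|ki] := eqVneq k i; last first.
  by have [j ji jk] := third i k; exists j; apply: off.
(* For [k = i] the double bracket would leave a term [v j *m (u j *m Z)]; the result for another
   index [k'] is bracketed with [v k' *m u i] instead. *)
have [k' k'i _] := third i i; have [j ji jk'] := third i k'.
exists k'; have := LC (off _ _ k'i ji jk') (L_vu k'i).
rewrite commmxBl commmxZl !commmx_rank1 !dot_uv eqxx (negPf jk').
by rewrite eq_sym (negPf ji) scale1r !scale0r subrr scaler0 subr0.
Qed.

Let almost_in_mul0 Z x j k : L Z -> almost_in x -> j != k ->
  pairing (u j) x = 0 -> pairing (u k) x = 0 ->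
  L (Z *m x *m u k - pairing (u k) (Z *m x) *: e).
Proof.
move=> LZ' Tx jk ujx ukx.
have Lj : L (x *m u j) by have := Tx j; rewrite ujx scale0r subr0.
have Lk : L (x *m u k) by have := Tx k; rewrite ukx scale0r subr0.
have := LC (LC LZ' Lj) (L_vu jk).
rewrite commmx_rank1_rank1 dot_uv ukx eqxx scale1r scale0r subr0.
move/LD/(_ (LZ (pairing (u j) (Z *m v j)) Lk)); rewrite subrK.
move/LD/(_ (LZ (pairing (u k) (Z *m x)) (L_diag j i0))).
by rewrite scalerBr addrA subrK.
Qed.

(** The components of [x] along [v k] and a further [v j] are covered by [almost_in_mulv]. The rest
    is annihilated by [u k] and [u j], so its products with them are in [L] and it can take the
    place of [v i] in the double bracket. *)
Lemma almost_in_mul Z x : L Z -> almost_in x -> almost_in (Z *m x).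
Proof.
move=> LZ' Tx k; have [j jk _] := third k k.
pose x' := x - (pairing (u k) x *: v k + pairing (u j) x *: v j).
have Tx' : almost_in x'.
  rewrite /x' -scaleN1r; apply: almost_inD => //; apply: almost_inZ; apply: almost_inD;
  by apply: almost_inZ; apply: almost_in_v.
have ukx' : pairing (u k) x' = 0.
  rewrite pairingBr pairingDr !pairingZr !dot_uv eqxx eq_sym (negPf jk).
  by rewrite mulr1 mulr0 addr0 subrr.
have ujx' : pairing (u j) x' = 0.
  by rewrite pairingBr pairingDr !pairingZr !dot_uv eqxx (negPf jk) mulr1 mulr0 add0r subrr.
have := almost_in_mul0 LZ' Tx' jk ujx' ukx'.
have Tv : almost_in (Z *m (pairing (u k) x *: v k + pairing (u j) x *: v j)).
  by rewrite mulmxDr -!scalemxAr; apply: almost_inD; apply: almost_inZ; apply: almost_in_mulv.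
move/LD/(_ (Tv k)).
by rewrite addrACA -opprD -scalerDl -pairingDr -mulmxDl -mulmxDr /x' subrK.
Qed.

(** Bracketing [x u i0], corrected at [v i1 u i1], with [v i0 f], corrected at [v i2 u i2], gives
    [x f - pairing f x e] up to off-diagonal elements of [L]; the three indices are distinct so that
    the corrections do not interfere. *)
Lemma almost_in_all_rank1 (f : 'rV[K]_n) (x : 'cV[K]_n) :
  (forall x, almost_in x) -> (forall f i, L (v i *m f - pairing f (v i) *: e)) ->
  L (x *m f - pairing f x *: e).
Proof.
move=> Tx Tf.
have [i1 i10 _] := third i0 i0; have [i2 i20 i21] := third i0 i1.
have LP : L (x *m u i0 - pairing (u i0) x *: (v i1 *m u i1)).
  have := LD (Tx x i0) (LZ (pairing (u i0) x) (L_diag i0 i1)).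
  by rewrite scalerBr addrA subrK.
have LQ : L (v i0 *m f - pairing f (v i0) *: (v i2 *m u i2)).
  have := LD (Tf f i0) (LZ (pairing f (v i0)) (L_diag i0 i2)).
  by rewrite scalerBr addrA subrK.
have := LC LP LQ.
rewrite /commmx !(mulmxBl, mulmxBr) -!(scalemxAl, scalemxAr) !mul_rank1 !dot_uv eqxx.
rewrite (eq_sym i0) (negPf i20) (negPf i10) (eq_sym i1) (negPf i21).
rewrite !scale0r !scaler0 !subr0 scale1r.
set W := _ *: (_ *: _); set W' := _ *: (_ *: _).
have L1 : L W by do 2!apply: LZ; apply: L_vu'.
have L2 : L W' by do 2!apply: LZ; apply: L_vu.
rewrite -/e => LL.
have -> : pairing f x *: e = pairing f x *: e - W - W' + W' + W by rewrite !subrK.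
by move: (LB (LB LL L2) L1); rewrite (opprD _ W) (opprD _ W') !addrA.
Qed.

(** Writing [Z] as the sum of its columns times unit rows, the corrections by multiples of [e] add
    up to [\tr Z *: e]. *)
Lemma lie_closed_traceless (Z : 'M[K]_n) :
  (forall x, almost_in x) -> (forall f i, L (v i *m f - pairing f (v i) *: e)) ->
  \tr Z = 0 -> L Z.
Proof.
move=> Tx Tf trZ.
have -> : Z = \sum_j (col j Z *m delta_mx 0 j - pairing (delta_mx 0 j) (col j Z) *: e).
  rewrite sumrB -scaler_suml.
  have -> : \sum_j pairing (delta_mx 0 j) (col j Z) = \tr Z.
    by apply: eq_bigr => j _; rewrite /pairing -rowE !mxE.
  rewrite trZ scale0r subr0; apply/matrixP=> i j; rewrite summxE (bigD1 j) //= big1.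
    by rewrite addr0 !mxE big_ord1 !mxE eqxx mulr1.
  by move=> k kj; rewrite !mxE big_ord1 !mxE (eq_sym j) (negPf kj) andbF mulr0.
by apply: big_ind => // j _; apply: almost_in_all_rank1.
Qed.
End Extend.

(** * Isolated differences of eigenvalues *)

Lemma char_poly_tr (R : comNzRingType) n (A : 'M[R]_n) : char_poly A^T = char_poly A.
Proof.
rewrite /char_poly -[RHS]det_tr; congr determinant.
by rewrite /char_poly_mx linearB /= tr_scalar_mx map_trmx.
Qed.

Lemma horner_mx_prodXsubC (K : comNzRingType) n' (A : 'M[K]_n'.+1) (rs : seq K) :
  horner_mx A (\prod_(r <- rs) ('X - r%:P)) = \prod_(r <- rs) (A - r%:M).
Proof.
rewrite rmorph_prod /=; apply: eq_bigr => r _.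
by rewrite rmorphB /= horner_mx_X horner_mx_C.
Qed.

Section IterAd.
Variables (K : fieldType) (n' : nat).
Local Notation n := n'.+1.
Variable A : 'M[K]_n.

(** A product of operators [ad A - m], encoded by its list of roots so that single factors can be
    split off. *)
Definition iter_ad (ms : seq K) (X : 'M[K]_n) : 'M[K]_n :=
  foldr (fun m Y => commmx A Y - m *: Y) X ms.

Lemma iter_ad_cat s t X : iter_ad (s ++ t) X = iter_ad s (iter_ad t X).
Proof. exact: foldr_cat. Qed.

Lemma iter_adMr s X C : GRing.comm C A -> iter_ad s (X * C) = iter_ad s X * C.
Proof.
move=> CA; elim: s => //= m s ->.
rewrite /commmx !mulmxE -mulrA CA !mulrA -mulrBl scalerAl.
by rewrite -mulrBl.
Qed.

(* [ad A - (k - l)] is left multiplication by [A - k] modulo right multiples of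
   [A - l]. *)
Lemma iter_ad_diff ks l X : exists Y,
  iter_ad [seq k - l | k <- ks] X = \prod_(k <- ks) (A - k%:M) * X + Y * (A - l%:M).
Proof.
elim: ks => [|k ks [Y IH]] /=; first by exists 0; rewrite big_nil mul1r mul0r addr0.
rewrite IH big_cons; set G := \prod_(j <- ks) _.
exists (commmx A Y - (k - l) *: Y - G * X).
have key H : commmx A H - (k - l) *: H = (A - k%:M) * H - H * (A - l%:M).
  rewrite mulrBl mulrBr -!mulmxE mul_scalar_mx mul_mx_scalar scalerBl /commmx.
  by rewrite !opprB addrACA [RHS]addrACA; congr (_ + _); rewrite addrC.
rewrite !key; move: (A - k%:M) (A - l%:M) => D C.
rewrite mulrDr mulrDl !mulrBl !mulrA -!addrA; congr (_ + _); congr (_ + _).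
by rewrite -!opprD addrC.
Qed.

(** For a fixed [l], the factors [ad A - (k - l)] over all eigenvalues [k] leave a product ending in
    [A - l], by Cayley-Hamilton. Collecting these over all [l] gives zero, by Cayley-Hamilton again.
    Two lists are used so that the eigenvalues can be enumerated in different orders. *)
Lemma iter_ad_char_poly (rs1 rs2 : seq K) X :
  char_poly A = \prod_(r <- rs1) ('X - r%:P) ->
  char_poly A = \prod_(r <- rs2) ('X - r%:P) ->
  iter_ad (flatten [seq [seq k - l | k <- rs1] | l <- rs2]) X = 0.
Proof.
have hp := horner_mx_prodXsubC A.
move=> chi1 chi2.
have [Y ->] : exists Y, iter_ad (flatten [seq [seq k - l | k <- rs1] | l <- rs2]) X =
    Y * \prod_(l <- rs2) (A - l%:M).
  elim: rs2 {chi2} => [|l ls [Y IH]] /=; first by exists X; rewrite big_nil mulr1.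
  rewrite iter_ad_cat IH iter_adMr; last by rewrite -hp; exact/commr_sym/comm_mx_horner.
  have [Y' ->] := iter_ad_diff rs1 l Y.
  rewrite -(hp rs1) -chi1 Cayley_Hamilton mul0r add0r; exists Y'.
  by rewrite big_cons mulrA.
by rewrite -hp -chi2 Cayley_Hamilton mulr0.
Qed.

End IterAd.

Lemma coprimep_prodXsubC (K : fieldType) (p : {poly K}) (s : seq K) :
  (forall z, z \in s -> ~~ root p z) -> coprimep (\prod_(z <- s) ('X - z%:P)) p.
Proof.
elim: s => [|z s IH] H; first by rewrite big_nil coprime1p.
rewrite big_cons coprimepMl; apply/andP; split; last first.
  by apply: IH => y ys; apply: H; rewrite inE ys orbT.
by rewrite coprimep_sym coprimep_XsubC; apply: H; rewrite mem_head.
Qed.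

Section Isolated.
Variables (K : fieldType) (n' : nat).
Local Notation n := n'.+1.
Variables (a b : K) (rs : seq K).
Hypotheses (ab : a != b) (a_rs : a \notin rs) (b_rs : b \notin rs).
Hypothesis iso : forall r s, r \in [:: a, b & rs] -> s \in [:: a, b & rs] ->
  r - s = a - b -> r = a /\ s = b.

(** As [A M = M (A + (a - b))], the shifted characteristic polynomial yields
    [M (A - b) chi2(A) = 0], while [(A - b) chi1(A) = 0]. A common root of [chi1] and [chi2] would
    be a second pair with difference [a - b], so the two are coprime and Bezout applies. *)
Lemma isolated_eigen_row (A M : 'M[K]_n) :
  char_poly A = \prod_(r <- [:: a, b & rs]) ('X - r%:P) ->
  commmx A M = (a - b) *: M -> M * (A - b%:M) = 0.
Proof.
move=> chiA cM.
have hp := horner_mx_prodXsubC A.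
have sM c (X : 'M[K]_n) : c%:M * X = c *: X by exact: mul_scalar_mx.
have Ms c (X : 'M[K]_n) : X * c%:M = c *: X by exact: mul_mx_scalar.
have AM : A * M = M * (A + (a - b)%:M).
  by rewrite mulrDr Ms -cM /commmx !mulmxE addrC subrK.
have shift (s : seq K) :
    \prod_(r <- s) (A - r%:M) * M = M * \prod_(r <- s) (A - (r - (a - b))%:M).
  elim: s => [|r s IH]; first by rewrite !big_nil mul1r mulr1.
  rewrite !big_cons -mulrA IH !mulrA; congr (_ * _).
  rewrite mulrBl AM mulrDr Ms sM [RHS]mulrBr Ms -addrA -scalerBl -scaleNr.
  by rewrite opprB.
pose chi1 := \prod_(r <- a :: rs) ('X - r%:P).
pose chi2 := \prod_(r <- [seq r - (a - b) | r <- b :: rs]) ('X - r%:P).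
have E1 : (A - b%:M) * horner_mx A chi1 = 0.
  have := Cayley_Hamilton A; rewrite chiA hp /chi1 hp !big_cons => <-.
  rewrite !mulrA; congr (_ * _); rewrite !(mulrBl, mulrBr) !Ms !sM !scale_scalar_mx.
  by rewrite !opprB [b * a]mulrC addrACA [RHS]addrACA; congr (_ + _); rewrite addrC.
have E2 : M * (A - b%:M) * horner_mx A chi2 = 0.
  have := shift [:: a, b & rs].
  rewrite -hp -chiA Cayley_Hamilton mul0r => /esym E; rewrite -[RHS]E.
  by rewrite /chi2 hp big_map !big_cons subKr !mulrA.
have cop : coprimep chi1 chi2.
  apply: coprimep_prodXsubC => z; rewrite inE => zr; rewrite root_prod_XsubC.
  apply/mapP => -[r]; rewrite inE => rr zE.
  have [ra _] : r = a /\ z = b.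
    apply: iso; rewrite ?inE.
    - by case/orP: rr => ->; rewrite !orbT.
    - by case/orP: zr => ->; rewrite ?orbT.
    by rewrite zE subKr.
  by move: rr; rewrite ra (negPf ab) (negPf a_rs).
have /Bezout_eq1_coprimepP [[p1 p2] /= pq] := cop.
have := rmorph1 (horner_mx A); rewrite -pq rmorphD !rmorphM /= => id1.
rewrite -[LHS]mulr1 -id1 mulrDr.
rewrite -!(rmorphM (horner_mx A)) [p1 * _]mulrC [p2 * _]mulrC !rmorphM /=.
by rewrite mulrA -(mulrA M) E1 mulr0 mul0r add0r mulrA E2 mul0r.
Qed.

End Isolated.

Lemma isolated_rank1 (K : fieldType) n' (A B : 'M[K]_n'.+1) (a b : K) (rs : seq K)
    (L : 'M[K]_n'.+1 -> Prop) (va vb : 'cV_n'.+1) (ua ub : 'rV_n'.+1) :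
  lie_closed L -> L A -> L B ->
  a != b -> a \notin rs -> b \notin rs ->
  (forall r s, r \in [:: a, b & rs] -> s \in [:: a, b & rs] ->
     r - s = a - b -> r = a /\ s = b) ->
  char_poly A = \prod_(r <- [:: a, b & rs]) ('X - r%:P) ->
  A *m va = a *: va -> va != 0 -> A *m vb = b *: vb ->
  ua *m A = a *: ua -> ub *m A = b *: ub -> ub != 0 ->
  pairing ua (B *m vb) != 0 -> L (va *m ub).
Proof.
move=> lieL LA LB ab a_rs b_rs iso chiA Ava nzva Avb uaA ubA nzub nzB.
have LC := lie_closed_comm lieL; have LZ := lie_closedZ lieL; have LD := lie_closedD lieL.
have Liter ms X : L X -> L (iter_ad A ms X).
  move=> LX; elim: ms => //= m ms IH; apply: (LD _ _ (LC _ _ LA IH)).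
  by rewrite -scaleNr; apply: LZ.
(* All differences of eigenvalues except one occurrence of [a - b]: with [a] first among the [k] and
   [b] first among the [l], this is the tail of the list in [iter_ad_char_poly]. *)
pose rest := [seq k - b | k <- b :: rs] ++
   flatten [seq [seq k - l | k <- [:: a, b & rs]] | l <- a :: rs].
pose M := iter_ad A rest B.
have LM : L M by apply: Liter.
have chiA' : char_poly A = \prod_(r <- [:: b, a & rs]) ('X - r%:P).
  by rewrite chiA !big_cons mulrCA.
have cM : commmx A M = (a - b) *: M.
  have := iter_ad_char_poly B chiA chiA'.
  by rewrite /= -/M => /eqP; rewrite subr_eq0 => /eqP.
(* Between [ua] and [vb], the operator [ad A] acts as multiplication by [a - b]; isolation keeps
   every factor of the product away from zero. *)
have nzM : pairing ua (M *m vb) != 0.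
  have E ms X : pairing ua (iter_ad A ms X *m vb) =
      \prod_(m <- ms) (a - b - m) * pairing ua (X *m vb).
    elim: ms => [|m ms IH] /=; first by rewrite big_nil mul1r.
    rewrite big_cons -mulrA -IH /commmx; set Y := iter_ad _ _ _.
    rewrite !mulmxBl -!mulmxA Avb -scalemxAl !pairingBr pairingZr.
    have -> : pairing ua (A *m (Y *m vb)) = a * pairing ua (Y *m vb).
      by rewrite {1}/pairing mulmxA uaA -scalemxAl mxE.
    by rewrite -scalemxAr pairingZr -!mulrBl.
  rewrite /M E mulf_neq0 // prodf_seq_neq0; apply/allP => m mrest.
  apply/implyP => _; rewrite subr_eq0 eq_sym; apply/eqP => mab.
  have [k [l [kr lr klE kb]]] : exists k l, [/\ k \in [:: a, b & rs],
      l \in [:: a, b & rs], m = k - l & k \in b :: rs \/ l \in a :: rs].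
    move: mrest; rewrite mem_cat => /orP[/mapP[k kr ->]|/flatten_mapP[l lr /mapP[k kr ->]]].
      exists k, b; split=> //; first by rewrite in_cons kr orbT.
        by rewrite !inE eqxx orbT.
      by left.
    exists k, l; split=> //; last by right.
    by move: lr; rewrite !inE => /orP[] ->; rewrite ?orbT.
  have [ka lb] := iso _ _ kr lr (etrans (esym klE) mab).
  case: kb; rewrite inE ?ka ?lb; first by rewrite (negPf ab) (negPf a_rs).
  by rewrite eq_sym (negPf ab) (negPf b_rs).
have M1 : M * (A - b%:M) = 0 by apply: (isolated_eigen_row ab a_rs iso).
(* Transposition changes the sign of [ad A], which exchanges [a] and [b]. *)
have M2 : M^T * (A^T - a%:M) = 0.
  apply: (@isolated_eigen_row _ _ b a rs) => //; first by rewrite eq_sym.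
  - move=> r s rr sr rs_ba; have [||/=|-> ->] := iso s r => //.
    + by move: sr; rewrite !inE orbCA.
    + by move: rr; rewrite !inE orbCA.
    by apply: oppr_inj; rewrite !opprB.
  - by rewrite char_poly_tr.
  have /(congr1 trmx) := cM.
  rewrite /commmx linearB /= !trmx_mul linearZ /= => E.
  by rewrite -opprB E -scaleNr opprB.
have sub_ub : (M <= ub)%MS.
  apply/row_subP=> i.
  have [c ->] : exists c, row i M = c *: ub.
    apply: (@simple_eigenspace _ _ A b (\prod_(r <- a :: rs) ('X - r%:P))) => //.
    - by rewrite chiA' big_cons.
    - by rewrite root_prod_XsubC inE eq_sym (negPf ab) (negPf b_rs).
    have /(congr1 (row i)) := M1; rewrite -mulmxE row_mul mulmxBr mul_mx_scalar row0.
    by move/eqP; rewrite subr_eq0 => /eqP.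
  exact: scalemx_sub.
have [D ME] := submxP sub_ub.
have free_ub : row_free ub by rewrite /row_free rank_rV nzub.
have AD : A *m D = a *: D.
  apply: (row_free_inj free_ub); rewrite /= -scalemxAl -mulmxA -ME; apply: trmx_inj.
  move/eqP: M2; rewrite mulrBr -!mulmxE mul_mx_scalar subr_eq0 => /eqP M2.
  by rewrite trmx_mul M2 linearZ.
have [c Dc] : exists c, D^T = c *: va^T.
  apply: (@simple_eigenspace _ _ A^T a (\prod_(r <- b :: rs) ('X - r%:P))).
  - by rewrite char_poly_tr chiA big_cons.
  - by rewrite root_prod_XsubC inE (negPf ab) (negPf a_rs).
  - by rewrite -(trmx0 _ n'.+1 1) (inj_eq trmx_inj).
  - by rewrite -trmx_mul Ava linearZ.
  by rewrite -trmx_mul AD linearZ.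
have Mc : M = c *: (va *m ub).
  by rewrite ME scalemxAl; congr (_ *m _); apply: trmx_inj; rewrite Dc linearZ.
have nzc : c != 0.
  apply: contraNneq nzM => c0.
  by rewrite Mc c0 scale0r mul0mx /pairing mulmx0 mxE.
have -> : va *m ub = c^-1 *: M by rewrite Mc scalerA mulVf // scale1r.
exact: LZ.
Qed.

(** * A generation criterion *)

Section ScalarExtension.
Variables (F : finFieldType) (K : fieldType) (fK : {rmorphism F -> K}) (n : nat).
Variable L : {set 'M[F]_n}.
Hypothesis lieL : lie_subalgebra L.
Local Notation fr := (frob fK).

Let L0 : 0 \in L. Proof. by case/and3P: lieL. Qed.
Let LZD a X Y : X \in L -> Y \in L -> a *: X + Y \in L.
Proof.
by case/and3P: lieL => _ /forallP/(_ a)/forall_inP H _ /H /forall_inP; apply.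
Qed.
Let LC X Y : X \in L -> Y \in L -> lie_bracket X Y \in L.
Proof. by case/and3P: lieL => _ _ /forall_inP H /H /forall_inP; apply. Qed.

Definition rows_of_set : 'M[F]_(#|L|, n * n) := \matrix_i mxvec (enum_val i).

(** The [K]-span of [L] as a row space of vectorised matrices. Inclusion of row spaces of matrices
    over [F] is the same over [F] and over [K], which gives the descent back to [L]. *)
Definition scalar_ext (X : 'M[K]_n) : Prop :=
  (mxvec X <= map_mx fK rows_of_set)%MS.

Lemma scalar_extP (X : 'M[F]_n) : scalar_ext (map_mx fK X) -> X \in L.
Proof.
rewrite /scalar_ext -map_mxvec map_submx => /submxP[D].
move/(congr1 vec_mx); rewrite mxvecK mulmx_sum_row linear_sum /= => ->.
apply: (big_ind (fun Y => Y \in L)) => // [Y Z YL ZL|i _].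
  by rewrite -[Y]scale1r LZD.
rewrite rowK linearZ /= mxvecK -[_ *: _]addr0 LZD //; exact: enum_valP.
Qed.

Lemma mem_scalar_ext (X : 'M[F]_n) : X \in L -> scalar_ext (map_mx fK X).
Proof.
move=> XL; rewrite /scalar_ext -map_mxvec map_submx.
have -> : mxvec X = row (enum_rank_in XL X) rows_of_set.
  by rewrite rowK enum_rankK_in.
exact: row_sub.
Qed.

Lemma scalar_ext_ind (Q : 'M[K]_n -> Prop) :
  Q 0 -> (forall X Y, Q X -> Q Y -> Q (X + Y)) -> (forall a X, Q X -> Q (a *: X)) ->
  (forall X : 'M[F]_n, X \in L -> Q (map_mx fK X)) ->
  forall X, scalar_ext X -> Q X.
Proof.
move=> Q0 QD QZ QL X /submxP[D].
move/(congr1 vec_mx); rewrite mxvecK mulmx_sum_row linear_sum /= => ->.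
apply: (big_ind Q) => // i _; rewrite linearZ /= -map_row rowK map_mxvec mxvecK.
by apply: QZ; apply: QL; exact: enum_valP.
Qed.

Lemma scalar_ext_lie_closed : lie_closed scalar_ext.
Proof.
have SD X Y : scalar_ext X -> scalar_ext Y -> scalar_ext (X + Y).
  by move=> SX SY; rewrite /scalar_ext linearD /=; apply: addmx_sub.
have SZ a X : scalar_ext X -> scalar_ext (a *: X).
  by move=> SX; rewrite /scalar_ext linearZ /=; apply: scalemx_sub.
have S0 : scalar_ext 0 by rewrite /scalar_ext linear0 sub0mx.
split=> // X Y SX SY.
apply: (scalar_ext_ind (Q := fun X => scalar_ext (commmx X Y))) SX.
- by rewrite /commmx mul0mx mulmx0 subrr.
- move=> X1 X2 S1 S2.
  have -> : commmx (X1 + X2) Y = commmx X1 Y + commmx X2 Y.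
    by rewrite /commmx mulmxDl mulmxDr opprD addrACA.
  exact: SD.
- by move=> a X1 S1; rewrite commmxZl; apply: SZ.
move=> X' X'L.
apply: (scalar_ext_ind (Q := fun Y => scalar_ext (commmx (map_mx fK X') Y))) SY.
- by rewrite /commmx mul0mx mulmx0 subrr.
- move=> X1 X2 S1 S2.
  have -> : commmx (map_mx fK X') (X1 + X2) = commmx (map_mx fK X') X1 + commmx (map_mx fK X') X2.
    by rewrite /commmx mulmxDl mulmxDr opprD addrACA.
  exact: SD.
- move=> a X1 S1.
  have -> : commmx (map_mx fK X') (a *: X1) = a *: commmx (map_mx fK X') X1.
    by rewrite /commmx -scalemxAl -scalemxAr scalerBr.
  exact: SZ.
move=> Y' Y'L; rewrite /commmx -!map_mxM -map_mxB; apply: mem_scalar_ext.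
exact: LC.
Qed.

Lemma scalar_ext_frob X : scalar_ext X -> scalar_ext (map_mx fr X).
Proof.
rewrite /scalar_ext -map_mxvec -(map_submx fr) -map_mx_comp.
rewrite (_ : map_mx (fr \o fK) rows_of_set = map_mx fK rows_of_set) //.
by apply/matrixP=> i j; rewrite !mxE /= frob_base.
Qed.
End ScalarExtension.

Lemma ord_third d (i j : 'I_d) : (2 < d)%N -> exists2 k, k != i & k != j.
Proof.
move=> d3; have /card_gt0P[k] : (0 < #|~: [set i; j]|)%N.
  rewrite cardsCs setCK card_ord subn_gt0 (leq_ltn_trans _ d3) //.
  by rewrite cards2; case: (_ != _).
by rewrite !inE negb_or => /andP[ki kj]; exists k.
Qed.

Definition linear_pred (R : pzRingType) m n (P : 'M[R]_(m, n) -> Prop) :=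
  (forall x y, P x -> P y -> P (x + y)) /\ (forall a x, P x -> P (a *: x)).

(** * Spreading one rank one matrix by Frobenius *)

Section Generate.
Variables (F : finFieldType) (K : fieldType) (fK : {rmorphism F -> K}) (n' : nat).
Local Notation n := n'.+1.
Local Notation fr := (frob fK).
Variables (A B : 'M[F]_n) (lam : K) (d : nat) (rs : seq K).
Variables (v : 'cV[K]_n) (u : 'rV[K]_n) (wc : 'cV[F]_n) (wr : 'rV[F]_n).
Hypothesis d3 : (2 < d)%N.
Hypothesis lam_inj : forall i j, (i < d)%N -> (j < d)%N -> iter i fr lam = iter j fr lam -> i = j.
Hypothesis lam_rs : lam \notin rs.
Hypothesis lam1_rs : fr lam \notin rs.
Hypothesis iso : forall r s, r \in [:: lam, fr lam & rs] -> s \in [:: lam, fr lam & rs] ->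
  r - s = lam - fr lam -> r = lam /\ s = fr lam.
Hypothesis chiA : char_poly (map_mx fK A) = \prod_(r <- [:: lam, fr lam & rs]) ('X - r%:P).
Hypothesis Av : map_mx fK A *m v = lam *: v.
Hypothesis uA : u *m map_mx fK A = lam *: u.
Hypothesis uv : pairing u v = 1.
Local Notation v_ i := (iter i (map_mx fr) v).
Local Notation u_ i := (iter i (map_mx fr) u).
Hypothesis v_d : v_ d = v.
Hypothesis u_d : u_ d = u.
Hypothesis nzB : pairing u (map_mx fK B *m map_mx fr v) != 0.
Hypothesis wcE : map_mx fK wc = \sum_(i < d) v_ i.
Hypothesis wrE : map_mx fK wr = \sum_(i < d) u_ i.
Hypothesis irr_col : forall P : 'cV[F]_n -> Prop, linear_pred P ->
  (forall x, P x -> P (A *m x)) -> (forall x, P x -> P (B *m x)) -> P wc -> forall x, P x.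
Hypothesis irr_row : forall P : 'rV[F]_n -> Prop, linear_pred P ->
  (forall x, P x -> P (x *m A)) -> (forall x, P x -> P (x *m B)) -> P wr -> forall x, P x.

Let frA (M : 'M[F]_n) : map_mx fr (map_mx fK M) = map_mx fK M.
Proof. by apply/matrixP=> i j; rewrite !mxE frob_base. Qed.

Let Av_ i : map_mx fK A *m v_ i = iter i fr lam *: v_ i.
Proof. by elim: i => //= i IH; rewrite -{1}frA -map_mxM IH map_mxZ. Qed.

Let uA_ i : u_ i *m map_mx fK A = iter i fr lam *: u_ i.
Proof. by elim: i => //= i IH; rewrite -{1}frA -map_mxM IH map_mxZ. Qed.

Let pairing_fr (f : 'rV[K]_n) (x : 'cV[K]_n) :
  pairing (map_mx fr f) (map_mx fr x) = fr (pairing f x).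
Proof. by rewrite /pairing -map_mxM mxE. Qed.

Let u_v_ i : pairing (u_ i) (v_ i) = 1.
Proof. by elim: i => //= i IH; rewrite pairing_fr IH rmorph1. Qed.

Let uv_ (i j : nat) : (i < d)%N -> (j < d)%N -> pairing (u_ i) (v_ j) = (i == j)%:R.
Proof.
move=> id jd; have [<-|ij] := eqVneq i j; first exact: u_v_.
have : iter i fr lam * pairing (u_ i) (v_ j) = iter j fr lam * pairing (u_ i) (v_ j).
  by rewrite -pairingZl -uA_ -pairingZr -Av_ /pairing mulmxA.
move/eqP; rewrite -subr_eq0 -mulrBl mulf_eq0 => /orP[|/eqP //].
by rewrite subr_eq0 => /eqP/lam_inj E; rewrite E ?eqxx in ij.
Qed.

Let u_period i : u_ (i + d) = u_ i. Proof. by rewrite iterD u_d. Qed.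

Let nz_pair (f : 'rV[K]_n) (x : 'cV[K]_n) : pairing f x = 1 -> f != 0 /\ x != 0.
Proof.
move=> E; split; apply/eqP => Z; move: E; rewrite Z /pairing ?mul0mx ?mulmx0 mxE;
by move/esym/eqP; rewrite oner_eq0.
Qed.

Variable L : {set 'M[F]_n}.
Hypothesis lieL : lie_subalgebra L.
Hypotheses (AL : A \in L) (BL : B \in L).
Local Notation LK := (scalar_ext fK L).

Let lieLK := scalar_ext_lie_closed fK lieL.

Let LK_step i : LK (v_ i *m u_ i.+1).
Proof.
elim: i => [|i IH]; last first.
  have -> : v_ i.+1 *m u_ i.+2 = map_mx fr (v_ i *m u_ i.+1) by rewrite map_mxM.
  exact: scalar_ext_frob.
have [_ nzv] := nz_pair (u_v_ 0); have [nzu _] := nz_pair (u_v_ 1).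
apply: (@isolated_rank1 _ _ (map_mx fK A) (map_mx fK B) lam (fr lam) rs _ v (v_ 1) u) => //.
- exact: mem_scalar_ext.
- exact: mem_scalar_ext.
- by apply/eqP => /(@lam_inj 0 1) E; have := E (ltnW (ltnW d3)) (ltnW d3).
Qed.

(** Consecutive matrices compose under the bracket, and the product in the opposite order vanishes
    as long as the indices have not come full circle. *)
Let LK_add i m : (m.+1 < d)%N -> LK (v_ i *m u_ (i + m.+1)).
Proof.
elim: m => [|m IH] md; first by rewrite addn1.
have := lie_closed_comm lieLK (IH (ltnW md)) (LK_step (i + m.+1)).
rewrite commmx_rank1 u_v_ scale1r -addnS.
rewrite (_ : pairing (u_ (i + m.+2)) (v_ i) = 0) ?scale0r ?subr0 //.
elim: i {IH} => [|i IHi]; first by rewrite add0n uv_ // (leq_trans _ d3).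
by rewrite addSn /= pairing_fr IHi rmorph0.
Qed.

Let LK_vu (i j : 'I_d) : i != j -> LK (v_ i *m u_ j).
Proof.
move=> ij; case: (ltngtP i j) => [lt|gt|/val_inj E]; last by rewrite E eqxx in ij.
  have := @LK_add i (j - i).-1.
  by rewrite prednK ?subn_gt0 // subnKC ?(ltnW lt) //; apply; apply: leq_ltn_trans (leq_subr _ _) _.
(* Indices are cyclic modulo [d], so [j] below [i] is reached as [j + d]. *)
rewrite -u_period.
have := @LK_add i (j + d - i).-1.
have ltd : (i < j + d)%N by rewrite (leq_trans (ltn_ord i)) // leq_addl.
rewrite prednK ?subn_gt0 // subnKC ?(ltnW ltd) //; apply.
by rewrite ltn_subLR ?(ltnW ltd) // ltn_add2r.
Qed.

Lemma generate_sl (Z : 'M[F]_n) : \tr Z = 0 -> Z \in L.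
Proof.
have d0 : (0 < d)%N by apply: leq_trans d3.
pose i0 := Ordinal d0.
pose V (i : 'I_d) := v_ i; pose U (i : 'I_d) := u_ i.
have UV i j : pairing (U i) (V j) = (i == j)%:R by rewrite uv_.
have third (i j : 'I_d) := ord_third i j d3.
have allc (x : 'cV[K]_n) : almost_in LK V U i0 x.
  have base (y : 'cV[F]_n) : almost_in LK V U i0 (map_mx fK y).
    apply: (irr_col (P := fun y => almost_in LK V U i0 (map_mx fK y))) => [|z Tz|z Tz|].
    - split=> [z t Tz Tt|a z Tz]; first by rewrite map_mxD; apply: almost_inD.
      by rewrite map_mxZ; apply: almost_inZ.
    - by rewrite map_mxM; apply: almost_in_mul => //; apply: mem_scalar_ext.
    - by rewrite map_mxM; apply: almost_in_mul => //; apply: mem_scalar_ext.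
    rewrite wcE; apply: (big_ind (almost_in LK V U i0)) => [|z t Tz Tt|i _].
    - by rewrite -(scale0r (V i0)); apply: almost_inZ => //; apply: almost_in_v.
    - exact: almost_inD.
    - exact: almost_in_v.
  have -> : x = \sum_i x i 0 *: map_mx fK (delta_mx i 0).
    rewrite {1}[x]matrix_sum_delta; apply: eq_bigr => i _.
    by rewrite big_ord1 map_delta_mx.
  apply: (big_ind (almost_in LK V U i0)) => [|z t Tz Tt|i _].
  - by rewrite -(scale0r (V i0)); apply: almost_inZ => //; apply: almost_in_v.
  - exact: almost_inD.
  - exact: almost_inZ.
(* The statement for rows is the one for columns in the transposed Lie algebra, where the two dual
   families exchange their roles. *)
pose LT X := LK X^T; pose VT i := (U i)^T; pose UT i := (V i)^T.
have lieLT : lie_closed LT.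
  split=> [X Y LX LY|a X LX|X Y LX LY]; rewrite /LT.
  - by rewrite linearD; apply: (lie_closedD lieLK).
  - by rewrite linearZ; apply: (lie_closedZ lieLK).
  rewrite linearB /= !trmx_mul -[_ - _]/(commmx Y^T X^T); exact: (lie_closed_comm lieLK).
have UVT i j : pairing (UT i) (VT j) = (i == j)%:R by rewrite pairing_tr UV eq_sym.
have LTvu i j : i != j -> LT (VT i *m UT j).
  by move=> ij; rewrite /LT trmx_mul !trmxK; apply: LK_vu; rewrite eq_sym.
have allr (x : 'rV[K]_n) : almost_in LT VT UT i0 x^T.
  have base (y : 'rV[F]_n) : almost_in LT VT UT i0 (map_mx fK y)^T.
    have tr_mem M : M \in L -> LT (map_mx fK M)^T.
      by move=> ML; rewrite /LT trmxK; apply: mem_scalar_ext.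
    apply: (irr_row (P := fun y => almost_in LT VT UT i0 (map_mx fK y)^T)) => [|z Tz|z Tz|].
    - split=> [z t Tz Tt|a z Tz]; first by rewrite map_mxD linearD; apply: almost_inD.
      by rewrite map_mxZ linearZ; apply: almost_inZ.
    - by rewrite map_mxM trmx_mul; apply: almost_in_mul => //; apply: tr_mem.
    - by rewrite map_mxM trmx_mul; apply: almost_in_mul => //; apply: tr_mem.
    rewrite wrE linear_sum /=; apply: (big_ind (almost_in LT VT UT i0)) => [|z t Tz Tt|i _].
    - by rewrite -(scale0r (VT i0)); apply: almost_inZ => //; apply: almost_in_v.
    - exact: almost_inD.
    - exact: (@almost_in_v _ _ _ _ VT UT).
  have -> : x^T = \sum_i x 0 i *: (map_mx fK (delta_mx 0 i))^T.
    rewrite {1}[x]matrix_sum_delta big_ord1 linear_sum; apply: eq_bigr => i _.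
    by rewrite map_delta_mx linearZ.
  apply: (big_ind (almost_in LT VT UT i0)) => [|z t Tz Tt|i _].
  - by rewrite -(scale0r (VT i0)); apply: almost_inZ => //; apply: almost_in_v.
  - exact: almost_inD.
  - exact: almost_inZ.
move=> trZ; apply: (@scalar_extP _ _ fK _ _ lieL).
apply: (lie_closed_traceless (v := V) (u := U) (i0 := i0)) => //.
  move=> f i; have := allr f i.
  by rewrite /LT linearB linearZ /= !trmx_mul !trmxK pairing_tr.
by rewrite trace_map_mx trZ rmorph0.
Qed.
End Generate.

(** * Krylov spaces *)

Lemma leq_card_bigcup (I T : finType) (S : {set T}) (B : I -> {set T}) :
  (forall x, x \in S -> exists i, x \in B i) -> (#|S| <= \sum_i #|B i|)%N.
Proof.
move=> H; apply: (@leq_trans #|\bigcup_i B i|).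
  apply/subset_leq_card/subsetP => x /H[i xi]; by apply/bigcupP; exists i.
apply: (big_ind2 (fun (X : {set T}) m => (#|X| <= m)%N)); rewrite ?cards0 //.
move=> X m Y k Xm Yk; apply: leq_trans (leq_add Xm Yk).
by rewrite cardsU leq_subr.
Qed.

Section Krylov.
Variables (F : fieldType) (n' : nat).
Local Notation n := n'.+1.
Implicit Types (A : 'M[F]_n) (w y : 'rV[F]_n).

Definition krylov A w k : 'M[F]_(k, n) := \matrix_(i < k) (w *m A ^+ i).

Lemma row_krylov A w k (i : 'I_k) : row i (krylov A w k) = w *m A ^+ i.
Proof. by rewrite rowK. Qed.

Lemma krylov_sub A w i k : (i < k)%N -> (w *m A ^+ i <= krylov A w k)%MS.
Proof. by move=> ik; rewrite -(row_krylov A w (Ordinal ik)) row_sub. Qed.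

Lemma krylovS A w k : (krylov A w k <= krylov A w k.+1)%MS.
Proof.
by apply/row_subP=> i; rewrite row_krylov krylov_sub // ltnS ltnW.
Qed.

Lemma krylov_free A w k :
  (forall i, (i < k)%N -> ~~ (w *m A ^+ i <= krylov A w i)%MS) ->
  row_free (krylov A w k).
Proof.
elim: k => [|k IH] H; first by rewrite /row_free eqn_leq rank_leq_row.
have {}IH := IH (fun i ik => H i (ltnW ik)).
rewrite /row_free eqn_leq rank_leq_row /=.
suff : (\rank (krylov A w k) < \rank (krylov A w k.+1))%N by rewrite (eqP IH).
rewrite rank_ltmx // ltmxE krylovS /=; apply: contra (H k (ltnSn k)).
exact: (submx_trans (krylov_sub A w (ltnSn k))).
Qed.

Lemma krylov_dim_exists A w : exists k, (w *m A ^+ k <= krylov A w k)%MS.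
Proof.
have [/existsP[i iP]|H] := boolP [exists i : 'I_n.+1, (w *m A ^+ i <= krylov A w i)%MS].
  by exists i.
have : row_free (krylov A w n.+1).
  apply: krylov_free => i ik; move: H; rewrite negb_exists => /forallP/(_ (Ordinal ik)).
  by [].
by move/eqP => rk; have := rank_leq_col (krylov A w n.+1); rewrite rk ltnn.
Qed.

Definition krylov_dim A w := ex_minn (krylov_dim_exists A w).

Lemma krylov_dimP A w k : reflect
  ((w *m A ^+ k <= krylov A w k)%MS /\
    forall i, (i < k)%N -> ~~ (w *m A ^+ i <= krylov A w i)%MS)
  (krylov_dim A w == k).
Proof.
rewrite /krylov_dim; case: ex_minnP => m mP mmin.
apply: (iffP eqP) => [<-|[kP kmin]].
  by split=> // i im; apply: contraTN im => /mmin; rewrite -leqNgt.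
apply/eqP; rewrite eqn_leq mmin // leqNgt /=; apply: contraTN mP.
exact: kmin.
Qed.

Lemma krylov_dim_free A w : row_free (krylov A w (krylov_dim A w)).
Proof. by have /krylov_dimP[_ /krylov_free] := eqxx (krylov_dim A w). Qed.

Lemma krylov_dim_le_rank A w m (E : 'M_(m, n)) :
  (w <= E)%MS -> (E *m A <= E)%MS -> (krylov_dim A w <= \rank E)%N.
Proof.
move=> wE EA; rewrite -(eqP (krylov_dim_free A w)); apply: mxrankS.
apply/row_subP=> i; rewrite row_krylov; elim: (nat_of_ord i) => [|k IH].
  by rewrite expr0 mulmx1.
by rewrite exprSr mulmxA (submx_trans _ EA) // submxMr.
Qed.

Lemma krylov_dim_gt0 A w : w != 0 -> (0 < krylov_dim A w)%N.
Proof.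
move=> nzw; rewrite lt0n; apply/negP => /krylov_dimP[+ _].
by rewrite expr0 mulmx1 => /submxP[D]; rewrite (flatmx0 (krylov A w 0)) mulmx0 => /eqP; apply/negP.
Qed.

Lemma krylov_dim_le A w : (krylov_dim A w <= n)%N.
Proof. by rewrite -(eqP (krylov_dim_free A w)) rank_leq_col. Qed.

(** If the Krylov vectors are free, this functional is 1 on the last of them and 0 on the others. It
    depends on [A] through the Krylov matrix only, so it can be recovered after [A] has been changed
    along it. *)
Definition krylov_dual A w j : 'cV[F]_n :=
  pinvmx (krylov A w j.+1) *m delta_mx ord_max 0.

Lemma krylov_dualP A w j i : krylov_dim A w = j.+1 -> (i <= j)%N ->
  (w *m A ^+ i *m krylov_dual A w j) = (i == j)%:R%:M.
Proof.
move=> kd ij; have free : row_free (krylov A w j.+1) by rewrite -kd krylov_dim_free.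
rewrite -ltnS in ij; rewrite -(row_krylov A w (Ordinal ij)) -row_mul.
rewrite mulmxA mulmxVp // mul1mx; apply/rowP=> k; rewrite !ord1 !mxE /= andbT.
by rewrite mulr1n -val_eqE.
Qed.

Section Update.
Variables (A : 'M[F]_n) (w : 'rV[F]_n) (j : nat).
Hypothesis kd : krylov_dim A w = j.+1.
Local Notation phi := (krylov_dual A w j).

Lemma krylov_update_pow y i : (i <= j)%N ->
  w *m (A + phi *m y) ^+ i = w *m A ^+ i.
Proof.
elim: i => [|i IH] ij; first by rewrite !expr0.
rewrite !exprSr !mulmxA IH ?(ltnW ij) // mulmxDr mulmxA krylov_dualP ?(ltnW ij) //.
by rewrite (ltn_eqF ij) raddf0 mul0mx addr0.
Qed.

Lemma krylov_update y k : (k <= j.+1)%N -> krylov (A + phi *m y) w k = krylov A w k.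
Proof.
move=> kj; apply/row_matrixP=> i; rewrite !row_krylov krylov_update_pow //.
by rewrite -ltnS (leq_trans (ltn_ord i)).
Qed.

Lemma krylov_update_last y :
  w *m (A + phi *m y) ^+ j.+1 = w *m A ^+ j.+1 + y.
Proof.
rewrite !exprSr !mulmxA krylov_update_pow // mulmxDr mulmxA krylov_dualP // eqxx.
by rewrite mul1mx.
Qed.

Lemma krylov_dim_update y : (y <= krylov A w j.+1)%MS ->
  krylov_dim (A + phi *m y) w = j.+1.
Proof.
move=> yk; have /eqP/krylov_dimP[kP kmin] := kd.
apply/eqP/krylov_dimP; split=> [|i ij].
  by rewrite krylov_update_last krylov_update // addmx_sub.
by rewrite krylov_update_pow -1?ltnS // krylov_update ?(ltnW ij) // kmin.
Qed.

(** The vector [w *m A ^+ j] is left out, so that the dual functional vanishes on the combination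
    and the rank one update is traceless. *)
Definition krylov_comb (c : {poly F}) : 'rV[F]_n := \sum_(i < j) c`_i *: (w *m A ^+ i).

Lemma krylov_comb_sub c : (krylov_comb c <= krylov A w j.+1)%MS.
Proof.
by apply: summx_sub => i _; apply/scalemx_sub/krylov_sub; rewrite ltnS ltnW.
Qed.

Lemma krylov_comb_dual c : krylov_comb c *m phi = 0.
Proof.
rewrite mulmx_suml big1 // => i _.
by rewrite -scalemxAl krylov_dualP ?(ltnW (ltn_ord i)) // ltn_eqF // raddf0 scaler0.
Qed.

Lemma resolvent_form_krylov i : (i <= j)%N ->
  resolvent_form A phi (w *m A ^+ i) = 'X^i * resolvent_form A phi w.
Proof.
elim: i => [|i IH] ij; first by rewrite !expr0 mulmx1 mul1r.
rewrite !exprSr mulmxA resolvent_form_mul IH ?(ltnW ij) // krylov_dualP ?(ltnW ij) //.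
by rewrite (ltn_eqF ij) !mxE polyC0 mulr0 subr0 mulrA commr_polyX.
Qed.

(** Along the Krylov sequence the numerators are ['X^i * psi]. The one of [w *m A ^+ j.+1] can be
    computed both by the recursion and by linear dependence on the earlier vectors; comparison
    factors [char_poly A]. A rank one update then subtracts the numerator [c * psi]. *)
Lemma char_poly_krylov : exists f psi : {poly F},
  [/\ f \is monic, size f = j.+2 & forall c : {poly F}, (size c <= j)%N ->
      char_poly (A + phi *m krylov_comb c) = (f - c) * psi].
Proof.
have /eqP/krylov_dimP[/submxP[D wD] _] := kd.
pose psi := resolvent_form A phi w.
pose g := \poly_(i < j.+1) D 0 (inord i).
have rg : resolvent_form A phi (w *m A ^+ j.+1) = g * psi.
  rewrite wD mulmx_sum_row resolvent_form_sum /g poly_def mulr_suml.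
  apply: eq_bigr => i _; rewrite row_krylov resolvent_formZ inord_val.
  by rewrite resolvent_form_krylov -1?ltnS // -mul_polyC mulrA.
have szg : (size g < j.+2)%N by rewrite ltnS size_poly.
have chi : char_poly A = ('X^(j.+1) - g) * psi.
  rewrite mulrBl -rg (exprSr A j) mulmxA resolvent_form_mul resolvent_form_krylov //.
  by rewrite krylov_dualP // eqxx !mxE mulr1n polyC1 mulr1 mulrA -exprS subKr.
exists ('X^(j.+1) - g), psi; split=> [||c szc].
- by rewrite monicE lead_coefDl ?lead_coefXn // size_polyN size_polyXn.
- by rewrite size_polyDl ?size_polyXn // size_polyN.
rewrite char_poly_rank1_update chi [RHS]mulrBl; congr (_ - _).
rewrite /krylov_comb resolvent_form_sum.
have cE : c = \poly_(i < j) c`_i.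
  apply/polyP=> i; rewrite coef_poly; case: ltnP => // ji.
  by rewrite nth_default // (leq_trans szc).
rewrite {2}cE poly_def mulr_suml; apply: eq_bigr => i _.
by rewrite resolvent_formZ resolvent_form_krylov ?(ltnW (ltn_ord i)) // -mul_polyC mulrA.
Qed.

End Update.

End Krylov.

(** * Traceless matrices with a small Krylov space *)

Section SlCount.
Variables (F : finFieldType) (n' : nat).
Local Notation n := n'.+1.
Local Notation q := #|F|.

Lemma mxtrace_delta00 : \tr (delta_mx 0 0 : 'M[F]_n) = 1.
Proof.
rewrite /mxtrace (bigD1 0) //= big1 ?addr0 ?mxE ?eqxx // => i /negPf i0.
by rewrite mxE i0.
Qed.

Lemma card_sl : (q ^ (n * n) <= #|sl F n| * q)%N.
Proof.
pose g (X : 'M[F]_n) := (X - \tr X *: delta_mx 0 0, \tr X).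
rewrite -card_mx -[q in leqRHS]cardsT -cardsX.
rewrite -[leqLHS](card_imset _ (f := g)).
  apply/subset_leq_card/subsetP=> _ /imsetP[X _ ->].
  by rewrite !inE /= linearB linearZ /= mxtrace_delta00 mulr1 subrr eqxx.
by move=> X Y [] + E; rewrite E => /addIr.
Qed.

(** Adding [krylov_dual A w j *m y] keeps the Krylov vectors up to exponent [j] and adds [y] to the
    next one. Recording the [j.+1] coordinates of that next vector before the change suffices to
    recover both [A] and [y]. The changed matrix need not be traceless, which costs one more factor
    [q]. *)
Lemma card_krylov_dim (w : 'rV[F]_n) j :
  (#|[set A in sl F n | krylov_dim A w == j.+1]| * q ^ n <= #|sl F n| * q ^ j.+2)%N.
Proof.
set S := [set A in _ | _].
pose g (p : 'M[F]_n * 'rV[F]_n) :=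
  (p.1 + krylov_dual p.1 w j *m p.2, w *m p.1 ^+ j.+1 *m pinvmx (krylov p.1 w j.+1)).
have ginj : {in setX S [set: 'rV[F]_n] &, injective g}.
  move=> [A y] [A' y']; rewrite !inE /= !andbT => /andP[_ /eqP kA] /andP[_ /eqP kA'].
  rewrite /g /= => -[E1 E2].
  have ek : krylov A w j.+1 = krylov A' w j.+1.
    by rewrite -(krylov_update kA y (leqnn _)) E1 krylov_update.
  have ed : krylov_dual A w j = krylov_dual A' w j by rewrite /krylov_dual ek.
  have ew : w *m A ^+ j.+1 = w *m A' ^+ j.+1.
    have /eqP/krylov_dimP[s _] := kA; have /eqP/krylov_dimP[s' _] := kA'.
    by rewrite -(mulmxKpV s) -(mulmxKpV s') E2 ek.
  have ey : y = y'.
    have := krylov_update_last kA y; rewrite E1 krylov_update_last // ew.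
    by move/addrI.
  by move: E1; rewrite ed ey => /addIr ->.
have : (#|S| * q ^ n <= q ^ (n * n) * q ^ j.+1)%N.
  have := max_card (mem (g @: setX S [set: 'rV[F]_n])).
  by rewrite card_in_imset // cardsX cardsT card_prod !card_mx !mul1n.
move/leq_trans; apply.
by rewrite [(q ^ j.+2)%N]expnS mulnA leq_mul2r card_sl orbT.
Qed.

Lemma card_krylov_dim_le (w : 'rV[F]_n) m : w != 0 -> (m < n)%N ->
  (#|[set A in sl F n | krylov_dim A w <= m]| * q ^ (n - m.+1) <= m * #|sl F n|)%N.
Proof.
move=> nzw mn; have q0 : (0 < q)%N by apply: ltnW; exact: finNzRing_gt1.
have le : (#|[set A in sl F n | krylov_dim A w <= m]| <=
   \sum_(j < m) #|[set A in sl F n | krylov_dim A w == j.+1]|)%N.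
  apply: leq_card_bigcup => A; rewrite inE => /andP[slA kA].
  have k0 := krylov_dim_gt0 A nzw.
  have km : ((krylov_dim A w).-1 < m)%N by rewrite prednK.
  by exists (Ordinal km); rewrite inE slA /= prednK.
apply: leq_trans (leq_mul le (leqnn _)) _.
rewrite big_distrl /= -[m in leqRHS]card_ord -sum_nat_const; apply: leq_sum => j _.
have := card_krylov_dim w j.
have jn : (j.+2 <= n)%N by apply: leq_trans mn; rewrite ltnS.
have -> : (q ^ n = q ^ (n - j.+2) * q ^ j.+2)%N by rewrite -expnD subnK.
rewrite mulnA leq_pmul2r ?expn_gt0 ?q0 //.
apply: leq_trans; rewrite leq_mul2l leq_pexp2l ?orbT //.
by rewrite leq_sub2l // ltnS.
Qed.
End SlCount.

(** * Random partners of a fixed matrix *)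

(** Each [t c] permutes [S], so the number of bad elements may be averaged over [c]; exchanging the
    sums leaves a count of the bad [c] for a fixed [x]. *)
Lemma translate_count (T C : finType) (S : {set T}) (t : C -> T -> T)
    (bad : pred T) (e : nat) :
  (forall c, {in S, forall x, t c x \in S}) -> (forall c, {in S &, injective (t c)}) ->
  (forall x, x \in S -> (#|[set c | bad (t c x)]| <= e)%N) ->
  (#|[set x in S | bad x]| * #|C| <= e * #|S|)%N.
Proof.
move=> tS tinj He.
have sub c : (#|[set x in S | bad x]| <= #|[set x in S | bad (t c x)]|)%N.
  have tSS : t c @: S = S.
    apply/eqP; rewrite eqEcard card_in_imset // leqnn andbT.
    by apply/subsetP => _ /imsetP[x xS ->]; apply: tS.
  apply: (@leq_trans #|t c @: [set x in S | bad (t c x)]|); last exact: leq_imset_card.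
  apply/subset_leq_card/subsetP => x; rewrite inE => /andP[].
  rewrite -{1}tSS => /imsetP[y yS ->] b; apply/imsetP; exists y => //.
  by rewrite inE yS.
rewrite mulnC -sum_nat_const.
apply: (@leq_trans (\sum_(c in C) #|[set x in S | bad (t c x)]|)); first exact: leq_sum.
have -> : (\sum_(c in C) #|[set x in S | bad (t c x)]| =
           \sum_(x in S) #|[set c | bad (t c x)]|)%N.
  under eq_bigr do rewrite -sum1dep_card.
  rewrite (exchange_big_dep (mem S)) /=; last by move=> c x _ /andP[].
  apply: eq_bigr => x xS; rewrite -sum1dep_card; apply: eq_bigl => c.
  by rewrite xS.
rewrite mulnC -sum_nat_const; exact: leq_sum.
Qed.

Section KrylovClosure.
Variables (F : finFieldType) (n' : nat).
Local Notation n := n'.+1.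

(* The annihilator of [P] has dimension at most [m] and is stable under both
   transposes. *)
Lemma krylov_closure (A B : 'M[F]_n) (w : 'rV[F]_n) m :
  (n - m <= krylov_dim B w)%N ->
  (forall f : 'rV[F]_n, f != 0 -> (krylov_dim A^T f <= m)%N ->
      (krylov_dim B^T f <= m)%N -> False) ->
  forall P : 'rV[F]_n -> Prop, linear_pred P ->
  (forall x, P x -> P (x *m A)) -> (forall x, P x -> P (x *m B)) -> P w -> forall x, P x.
Proof.
move=> kBw irr P [PD PZ] PA PB Pw.
have P0 : P 0 by rewrite -(scale0r w); apply: PZ.
pose E : 'M[F]_n := (\sum_(x : 'rV[F]_n | `[< P x >]) <<x>>)%MS.
have subE x : P x -> (x <= E)%MS.
  by move=> Px; rewrite -(genmxE x) (sumsmx_sup x) //; apply/asboolP.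
have inE x : (x <= E)%MS -> P x.
  move/sub_sumsmxP => [y ->]; apply: (big_ind P) => // z /asboolP Pz.
  have : (y z *m <<z>> <= z)%MS by rewrite -(genmxE z) submxMl.
  by move=> /sub_rVP[a ->]; apply: PZ.
have stabE (C : 'M[F]_n) : (forall x, P x -> P (x *m C)) -> (E *m C <= E)%MS.
  move=> PC; rewrite sumsmxMr_gen; apply/sumsmx_subP => x /asboolP Px.
  by rewrite genmxE (eqmxMr _ (genmxE x)) subE //; apply: PC.
have [full|nfull] := boolP (row_full E).
  by move=> x; apply: inE; apply: submx_full.
have rE : (n - m <= \rank E)%N.
  by apply: leq_trans kBw _; apply: krylov_dim_le_rank; [apply: subE | apply: stabE].
have rk : (\rank (kermx E^T) <= m)%N.
  by rewrite mxrank_ker mxrank_tr; rewrite leq_subLR addnC -leq_subLR.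
have nzk : kermx E^T != 0.
  rewrite -mxrank_eq0 mxrank_ker mxrank_tr subn_eq0 -ltnNge ltn_neqAle rank_leq_col andbT.
  exact: nfull.
have [i nzi] : exists i, row i (kermx E^T) != 0.
  apply/existsP; rewrite -negb_forall; apply: contra nzk => /forallP H.
  by apply/eqP/row_matrixP => i; rewrite row0; apply/eqP.
have stabK (C : 'M[F]_n) : (E *m C <= E)%MS -> (kermx E^T *m C^T <= kermx E^T)%MS.
  move=> /submxP[D ED]; apply/sub_kermxP.
  by rewrite -mulmxA -trmx_mul ED trmx_mul mulmxA mulmx_ker mul0mx.
exfalso; apply: (irr _ nzi); apply: leq_trans rk; apply: krylov_dim_le_rank;
  rewrite ?row_sub //; by apply: stabK; apply: stabE.
Qed.

Lemma krylov_closure_col (A B : 'M[F]_n) (w : 'cV[F]_n) m :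
  (n - m <= krylov_dim B^T w^T)%N ->
  (forall f : 'rV[F]_n, f != 0 -> (krylov_dim A f <= m)%N ->
      (krylov_dim B f <= m)%N -> False) ->
  forall P : 'cV[F]_n -> Prop, linear_pred P ->
  (forall x, P x -> P (A *m x)) -> (forall x, P x -> P (B *m x)) -> P w -> forall x, P x.
Proof.
move=> kBw irr P [PD PZ] PA PB Pw x; rewrite -[x]trmxK.
apply: (@krylov_closure A^T B^T w^T m kBw _ (fun y => P y^T)).
- by move=> f nzf; rewrite !trmxK; apply: irr.
- by split=> [y z Py Pz|a y Py]; rewrite ?linearD ?linearZ; [apply: PD | apply: PZ].
- by move=> y Py; rewrite trmx_mul trmxK; apply: PA.
- by move=> y Py; rewrite trmx_mul trmxK; apply: PB.
by rewrite trmxK.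
Qed.
End KrylovClosure.

Lemma horner_mx_eigen (K : fieldType) n' (A : 'M[K]_n'.+1) (a : K) (u : 'rV_n'.+1) (p : {poly K}) :
  u *m A = a *: u -> u *m horner_mx A p = p.[a] *: u.
Proof.
move=> uA; elim/poly_ind: p => [|p c IH]; first by rewrite rmorph0 mulmx0 horner0 scale0r.
rewrite rmorphD rmorphM /= horner_mx_X horner_mx_C -mulmxE mulmxDr mulmxA IH.
by rewrite -scalemxAl uA mul_mx_scalar scalerA hornerMXaddC scalerDl.
Qed.

(** * Eigenvectors of a simple eigenvalue and their Frobenius traces *)

Section EigenData.
Variables (F : finFieldType) (K : fieldType) (fK : {rmorphism F -> K}) (n' : nat).
Local Notation n := n'.+1.
Local Notation fr := (frob fK).
Variables (A : 'M[F]_n) (lam : K) (d : nat) (g : {poly K}).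
Hypothesis d0 : (0 < d)%N.
Hypothesis lam_d : iter d fr lam = lam.
Hypothesis lam_inj : forall i j, (i < d)%N -> (j < d)%N -> iter i fr lam = iter j fr lam -> i = j.
Hypothesis chiA : char_poly (map_mx fK A) = ('X - lam%:P) * g.
Hypothesis g_lam : ~~ root g lam.
Local Notation Ak := (map_mx fK A).

Let frA : map_mx fr Ak = Ak.
Proof. by apply/matrixP=> i j; rewrite !mxE frob_base. Qed.

Lemma eigen_iter_row i (u : 'rV_n) : u *m Ak = lam *: u ->
  iter i (map_mx fr) u *m Ak = iter i fr lam *: iter i (map_mx fr) u.
Proof. by move=> uA; elim: i => //= i IH; rewrite -{1}frA -map_mxM IH map_mxZ. Qed.

Lemma eigen_iter_col i (v : 'cV_n) : Ak *m v = lam *: v ->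
  Ak *m iter i (map_mx fr) v = iter i fr lam *: iter i (map_mx fr) v.
Proof. by move=> Av; elim: i => //= i IH; rewrite -{1}frA -map_mxM IH map_mxZ. Qed.

Lemma eigen_pairing0 a b (u : 'rV_n) (v : 'cV_n) :
  u *m Ak = a *: u -> Ak *m v = b *: v -> a != b -> pairing u v = 0.
Proof.
move=> uA Av ab; have : a * pairing u v = b * pairing u v.
  by rewrite -pairingZl -uA -pairingZr -Av /pairing mulmxA.
by move/eqP; rewrite -subr_eq0 -mulrBl mulf_eq0 subr_eq0 (negPf ab) => /eqP.
Qed.

Let iter_map_entry k m1 m2 (M : 'M[K]_(m1, m2)) i j :
  iter k (map_mx fr) M i j = iter k fr (M i j).
Proof. by elim: k => //= k IH; rewrite mxE IH. Qed.

Let iter_fr1 k : iter k fr 1 = 1.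
Proof. by elim: k => //= k ->; rewrite rmorph1. Qed.

(** Eigenvectors are unique only up to scalars. One coordinate of [v] is made equal to 1, which
    Frobenius preserves, and [u] is then fixed by its pairing with [v]; so the [d]-th Frobenius
    images are equal to [v] and [u], not just proportional. *)
Lemma eigen_data : exists (v : 'cV[K]_n) (u : 'rV[K]_n),
  [/\ Ak *m v = lam *: v, u *m Ak = lam *: u, pairing u v = 1,
      iter d (map_mx fr) v = v & iter d (map_mx fr) u = u].
Proof.
have rl : root (char_poly Ak) lam by rewrite chiA rootM root_XsubC eqxx.
have chiAT : char_poly Ak^T = ('X - lam%:P) * g by rewrite char_poly_tr.
have /eigenvalueP[u0 u0A nzu0] : eigenvalue Ak lam by rewrite eigenvalue_root_char.
have /eigenvalueP[v0 v0A nzv0] : eigenvalue Ak^T lam by rewrite eigenvalue_root_char chiAT -chiA.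
have [j nzj] : exists j, v0 0 j != 0 by apply/rV0Pn.
pose v := (v0 0 j)^-1 *: v0^T.
have Av : Ak *m v = lam *: v.
  rewrite /v -scalemxAr scalerA mulrC -scalerA; congr (_ *: _).
  by apply: trmx_inj; rewrite trmx_mul trmxK v0A linearZ /= trmxK.
have vj : v j 0 = 1 by rewrite !mxE mulVf.
have nzvT : v^T != 0 by apply/eqP => /rowP/(_ j)/eqP; rewrite !mxE mulVf // oner_eq0.
have v_unique (x : 'cV_n) : Ak *m x = lam *: x -> exists c, x = c *: v.
  move=> Ax; have vAT : v^T *m Ak^T = lam *: v^T by rewrite -trmx_mul Av linearZ.
  have xAT : x^T *m Ak^T = lam *: x^T by rewrite -trmx_mul Ax linearZ.
  have [c] := simple_eigenspace chiAT g_lam nzvT vAT xAT.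
  by move/(congr1 trmx); rewrite linearZ /= !trmxK; exists c.
(* By Cayley-Hamilton the columns of [g(A)] are multiples of [v]; if [u0] annihilated [v], then
   [u0 *m g(A) = g(lam) *: u0] would vanish. *)
have nzuv : pairing u0 v != 0.
  apply: contra g_lam => /eqP uv0; rewrite rootE.
  have E : u0 *m horner_mx Ak g = g.[lam] *: u0 by apply: horner_mx_eigen.
  have : g.[lam] *: u0 = 0.
    rewrite -E; apply/rowP=> k; rewrite -[LHS]/((u0 *m horner_mx Ak g) 0 k).
    have : Ak *m col k (horner_mx Ak g) = lam *: col k (horner_mx Ak g).
      have := Cayley_Hamilton Ak; rewrite chiA rmorphM rmorphB /= horner_mx_X horner_mx_C.
      rewrite -mulmxE mulmxBl mul_scalar_mx => /eqP; rewrite subr_eq0 => /eqP.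
      by move/(congr1 (col k)); rewrite linearZ /= !colE mulmxA.
    case/v_unique => c ck.
    have -> : (u0 *m horner_mx Ak g) 0 k = pairing u0 (col k (horner_mx Ak g)).
      by rewrite /pairing !mxE; apply: eq_bigr => l _; rewrite mxE.
    by rewrite ck pairingZr uv0 mulr0 mxE.
  by move/eqP; rewrite scaler_eq0 (negPf nzu0) orbF.
pose u := (pairing u0 v)^-1 *: u0.
have uA : u *m Ak = lam *: u by rewrite -scalemxAl u0A scalerA mulrC -scalerA.
have uv : pairing u v = 1 by rewrite pairingZl mulVf.
have nzu : u != 0 by rewrite scaler_eq0 invr_eq0 negb_or nzuv.
have vd : iter d (map_mx fr) v = v.
  have [|c E] := v_unique (iter d (map_mx fr) v).
    by rewrite eigen_iter_col // lam_d.
  have := congr1 (fun M : 'cV_n => M j 0) E.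
  by rewrite /= iter_map_entry vj mxE vj mulr1 iter_fr1 E => <-; rewrite scale1r.
have ud : iter d (map_mx fr) u = u.
  have udA : iter d (map_mx fr) u *m Ak = lam *: iter d (map_mx fr) u.
    by rewrite eigen_iter_row // lam_d.
  have [c E] := simple_eigenspace chiA g_lam nzu uA udA.
  have := pairingZl c u v; rewrite -E -{1}vd uv mulr1.
  have -> : pairing (iter d (map_mx fr) u) (iter d (map_mx fr) v) = iter d fr (pairing u v).
    by elim: (d) => //= k <-; rewrite /pairing -map_mxM mxE.
  by rewrite uv iter_fr1 E => <-; rewrite scale1r.
by exists v, u.
Qed.

Lemma frob_trace_descent m1 m2 (M : 'M[K]_(m1, m2)) : iter d (map_mx fr) M = M ->
  exists N : 'M[F]_(m1, m2), map_mx fK N = \sum_(i < d) iter i (map_mx fr) M.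
Proof.
move=> Md; set S := \sum_(i < d) _.
have SE : map_mx fr S = S.
  rewrite /S raddf_sum /=; case: d d0 Md => // e _ Me.
  rewrite big_ord_recr big_ord_recl /= -[map_mx fr (iter e _ _)]/(iter e.+1 (map_mx fr) M) Me.
  by rewrite addrC; congr (_ + _).
have H i j : exists a, S i j == fK a.
  have [a aE] : exists a, S i j = fK a.
    by apply: frob_fixed; rewrite -[in RHS]SE mxE.
  by exists a; apply/eqP.
exists (\matrix_(i, j) xchoose (H i j)); apply/matrixP=> i j; rewrite !mxE.
by rewrite -(eqP (xchooseP (H i j))).
Qed.

Lemma frob_trace_neq0 (u : 'rV_n) (v : 'cV_n) :
  Ak *m v = lam *: v -> u *m Ak = lam *: u -> pairing u v = 1 ->
  \sum_(i < d) iter i (map_mx fr) v != 0 /\ \sum_(i < d) iter i (map_mx fr) u != 0.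
Proof.
move=> Av uA uv.
have E1 : pairing u (\sum_(i < d) iter i (map_mx fr) v) = 1.
  case: d d0 lam_inj => // e _ inj.
  rewrite /pairing mulmx_sumr summxE big_ord_recl /= -/(pairing _ _) uv big1 ?addr0 // => i _.
  rewrite -/(pairing _ _); apply: (eigen_pairing0 uA (@eigen_iter_col i.+1 _ Av)).
  by apply/eqP => /(inj 0 i.+1) /=; rewrite ltnS => /(_ isT (ltn_ord i)).
have E2 : pairing (\sum_(i < d) iter i (map_mx fr) u) v = 1.
  case: d d0 lam_inj => // e _ inj.
  rewrite /pairing mulmx_suml summxE big_ord_recl /= -/(pairing _ _) uv big1 ?addr0 // => i _.
  rewrite -/(pairing _ _); apply: (eigen_pairing0 (@eigen_iter_row i.+1 _ uA) Av).
  by apply/eqP => /(inj i.+1 0) /=; rewrite ltnS => /(_ (ltn_ord i) isT).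
split; apply/eqP => Z.
  by move: E1; rewrite Z /pairing mulmx0 mxE => /esym/eqP; rewrite oner_eq0.
by move: E2; rewrite Z /pairing mul0mx mxE => /esym/eqP; rewrite oner_eq0.
Qed.

(* The [delta_mx 0 0] term of the translation [t] restores the trace. *)
Lemma card_pairing0 (u : 'rV[K]_n) (v : 'cV[K]_n) :
  u *m Ak = lam *: u -> u != 0 -> v != 0 ->
  (#|[set B in sl F n | pairing u (map_mx fK B *m v) == 0%R]| * #|F| ^ d <= #|F| * #|sl F n|)%N.
Proof.
move=> uA nzu nzv.
have [i nzi] : exists i, u 0 i != 0 by apply/rV0Pn.
have [j nzj] : exists j, v j 0 != 0 by apply/cV0Pn.
pose y (c : {poly F}) : 'cV[F]_n := horner_mx A c *m delta_mx i 0.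
pose t (c : {poly_d F}) (B : 'M[F]_n) := B + (y c *m delta_mx 0 j - y c j 0 *: delta_mx 0 0).
rewrite -card_npoly; apply: (translate_count (t := t)) => [c B|c B B' _ _|B _].
- rewrite !inE linearD linearB linearZ /= mxtrace_delta00 mulr1 => /eqP ->.
  by rewrite add0r mxtrace_mulC -rowE /mxtrace big_ord1 mxE subrr.
- exact: addIr.
pose c0 := [set c : {poly_d F} | pairing u (map_mx fK (t c B) *m v) == 0].
(* The trace correction involves [c] only through the scalar [y c j 0] of [F]. Once this is given,
   the vanishing of the pairing determines the value of [c] at [lam], hence [c], whose degree is
   below [d]. *)
apply: (@leq_trans #|[set (y c j 0) | c : {poly_d F} in c0]|); last exact: max_card.
rewrite card_in_imset // => c c'; rewrite !inE => /eqP Ec /eqP Ec' yy.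
have uy (p : {poly F}) : u *m map_mx fK (y p) = ((map_poly fK p).[lam] * u 0 i)%:M.
  rewrite /y map_mxM map_horner_mx mulmxA (horner_mx_eigen _ uA) -scalemxAl map_delta_mx.
  by apply/rowP=> k; rewrite !ord1 -colE !mxE mulr1n.
have Et (p : {poly_d F}) : pairing u (map_mx fK (t p B) *m v) =
   pairing u (map_mx fK B *m v) + ((map_poly fK p).[lam] * u 0 i) * v j 0
   - fK (y p j 0) * pairing u (map_mx fK (delta_mx 0 0) *m v).
  rewrite /t map_mxD map_mxB map_mxM map_mxZ mulmxDl pairingDr mulmxBl pairingBr addrA.
  congr (_ + _ - _); last by rewrite -scalemxAl pairingZr.
  rewrite /pairing !mulmxA uy -mulmxA mul_scalar_mx map_delta_mx -rowE.
  by rewrite !mxE.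
have : (map_poly fK c).[lam] = (map_poly fK c').[lam].
  apply: (mulIf nzi); apply: (mulIf nzj).
  move: (etrans Ec (esym Ec')); rewrite !Et yy => /addIr/addrI; by [].
move=> cc'; apply: val_inj => /=; apply/eqP; rewrite -subr_eq0; apply/negPn/negP => nz.
have nzm : map_poly fK (val c - val c') != 0 by rewrite map_poly_eq0.
have := @max_poly_roots _ _ [seq iter k fr lam | k <- iota 0 d] nzm.
rewrite size_map size_iota size_map_poly => H.
have : (d < size (val c - val c')%R)%N.
  apply: H.
    apply/allP => _ /mapP[k _ ->]; apply: root_iter_frob.
    by rewrite rmorphB rootE hornerD hornerN cc' subrr.
  by rewrite map_inj_in_uniq ?iota_uniq // => k l; rewrite !mem_iota; apply: lam_inj.
apply/negP; rewrite -leqNgt (leq_trans (size_polyD _ _)) // size_polyN geq_max.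
by rewrite !size_npoly.
Qed.
End EigenData.

(** * Counting polynomials over a finite field *)

Section MonicIrreducible.
Variable F : fieldType.
Implicit Types (P Q f g h : {poly F}).

Definition monic_irred P : bool := (P \is monic) && `[< irreducible_poly P >].

Lemma monic_irredP P : reflect (P \is monic /\ irreducible_poly P) (monic_irred P).
Proof. by apply: (iffP andP) => -[mP /asboolP iP]. Qed.

Lemma monic_irred_size P : monic_irred P -> (1 < size P)%N.
Proof. by case/monic_irredP => _ []. Qed.

Lemma monic_factor f : f \is monic -> (1 < size f)%N ->
  exists2 P, monic_irred P & P %| f.
Proof.
have [m] := ubnP (size f); elim: m f => // m IH f sf mf f1.
have [H|] := boolP `[< irreducible_poly f >].
  by exists f; rewrite ?dvdpp // /monic_irred mf H.
move/asboolPn => nirr.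
have [g gP] : exists g, [/\ size g != 1%N, g %| f & ~~ (g %= f)].
  apply: contrapT => H; apply: nirr; split => // g g1 gf.
  by apply: contrapT => /negP ngf; apply: H; exists g.
case: gP => g1 gf ngf.
have nzf := monic_neq0 mf.
have nzg : g != 0 by apply: contraNneq nzf => g0; move: gf; rewrite g0 dvd0p.
pose g' := (lead_coef g)^-1 *: g.
have mg' : g' \is monic by rewrite monicE lead_coefZ mulVf // lead_coef_eq0.
have sg' : size g' = size g by rewrite size_scale // invr_eq0 lead_coef_eq0.
have [P iP Pg] : exists2 P, monic_irred P & P %| g'.
  apply: IH => //.
    rewrite sg' -ltnS (leq_trans _ sf) // ltnS ltn_neqAle dvdp_leq // andbT.
    by rewrite dvdp_size_eqp.
  by rewrite sg' ltn_neqAle eq_sym g1 size_poly_gt0.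
exists P => //; apply: dvdp_trans Pg _.
by rewrite dvdpZl // invr_eq0 lead_coef_eq0.
Qed.

Lemma monic_irred_coprime P Q : monic_irred P -> monic_irred Q -> P != Q -> coprimep P Q.
Proof.
move=> /monic_irredP[mP iP] /monic_irredP[mQ iQ] PQ.
rewrite irreducible_poly_coprime //; apply: contra PQ => dPQ.
have E : P %= Q by apply: apply_irredp => //; case: iP => + _; case: (size P) => [|[]].
by rewrite -eqp_monic.
Qed.

Lemma prod_monic_irred_dvdp (s : seq {poly F}) g : uniq s -> all monic_irred s ->
  (forall P, P \in s -> P %| g) -> \prod_(P <- s) P %| g.
Proof.
elim: s => [|P s IH] /=; first by rewrite big_nil dvd1p.
move=> /andP[Ps us] /andP[iP is_] H; rewrite big_cons Gauss_dvdp.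
  rewrite H ?mem_head // IH // => Q Qs; apply: H; by rewrite inE Qs orbT.
elim: s Ps is_ {IH us H} => [|Q s IH] /=; first by rewrite big_nil coprimep1.
rewrite inE negb_or => /andP[PQ Ps] /andP[iQ is_].
by rewrite big_cons coprimepMr monic_irred_coprime // IH.
Qed.

Lemma size_prod_monic (s : seq {poly F}) : all (fun P => P \is monic) s ->
  size (\prod_(P <- s) P) = (\sum_(P <- s) (size P).-1).+1.
Proof.
elim: s => [|P s IH] /=; first by rewrite !big_nil size_poly1.
move=> /andP[mP ms]; rewrite !big_cons mulrC size_Mmonic //.
  rewrite IH // addSn -[size P]prednK ?size_poly_gt0 ?monic_neq0 //.
  by rewrite addnS /= addnC.
by rewrite monic_neq0 // big_seq monic_prod // => Q Qs; apply: (allP ms).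
Qed.
End MonicIrreducible.

Section PolyCount.
Variable F : finFieldType.
Local Notation q := #|F|.
Implicit Types (P Q f g h G : {poly F}).

Let q0 : (0 < q)%N. Proof. exact: ltnW (finNzRing_gt1 F). Qed.

Definition top_coefs k (tau : F) f : bool :=
  [&& f \is monic, size f == k.+1 & f`_k.-1 == tau].

Lemma top_coefs_sub k tau f g : (0 < k)%N -> top_coefs k tau f -> top_coefs k tau g ->
  (size (f - g)%R <= k.-1)%N.
Proof.
move=> k0 /and3P[mf /eqP sf /eqP cf] /and3P[mg /eqP sg /eqP cg].
apply/leq_sizeP => i ki; rewrite coefB.
have [->|ik1] := eqVneq i k.-1; first by rewrite cf cg subrr.
have {ki ik1}ki : (k <= i)%N by lia.
have [->|ik] := eqVneq i k.
  have := monicP mf; have := monicP mg; rewrite /lead_coef sf sg /= => -> ->.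
  by rewrite subrr.
by rewrite !nth_default ?subrr // ?sf ?sg; lia.
Qed.

Lemma card_top_coefs N k tau : (0 < k)%N ->
  (#|[set f : {poly_N F} | top_coefs k tau f]| <= q ^ k.-1)%N.
Proof.
move=> k0; set S := [set _ | _].
have [->|/set0Pn[f0 f0S]] := eqVneq S set0; first by rewrite cards0.
rewrite inE in f0S.
rewrite -card_npoly -(card_in_imset (f := fun f : {poly_N F} => npolyp k.-1 (val f - val f0))).
  exact: max_card.
move=> f g; rewrite !inE => fS gS /(congr1 val) /=.
rewrite !(@npolypK _ k.-1) ?(top_coefs_sub k0 _ f0S) // => /addIr; exact: val_inj.
Qed.

Lemma card_monic N m :
  (#|[set f : {poly_N F} | (val f \is monic) && (size (val f) == m.+1)]| <= q ^ m)%N.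
Proof.
set S := [set _ | _].
have [->|/set0Pn[f0]] := eqVneq S set0; first by rewrite cards0.
have sub (f g : {poly F}) : (f \is monic) && (size f == m.+1) ->
    (g \is monic) && (size g == m.+1) -> (size (f - g)%R <= m)%N.
  move=> /andP[mf /eqP sf] /andP[mg /eqP sg].
  apply/leq_sizeP => i mi; rewrite coefB.
  have [->|im] := eqVneq i m.
    have := monicP mf; have := monicP mg; rewrite /lead_coef sf sg /= => -> ->.
    by rewrite subrr.
  by rewrite !nth_default ?subrr // ?sf ?sg; lia.
rewrite inE => f0S.
rewrite -card_npoly -(card_in_imset (f := fun f : {poly_N F} => npolyp m (val f - val f0))).
  exact: max_card.
move=> f g; rewrite !inE => fS gS /(congr1 val) /=.
rewrite !(@npolypK _ m) ?(sub _ _ _ f0S) // => /addIr; exact: val_inj.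
Qed.

(* Dividing by a fixed monic [G] keeps the two leading coefficients under control. *)
Lemma card_top_coefs_dvd N k tau G (Qp : pred {poly F}) :
  (forall f h, Qp (h * f) -> Qp h) ->
  G \is monic -> (0 < (size G).-1 < k)%N ->
  exists tau', (#|[set f : {poly_N F} | [&& top_coefs k tau f, Qp f & (G %| f)%R]]| <=
    #|[set h : {poly_N F} | top_coefs (k - (size G).-1) tau' h && Qp h]|)%N.
Proof.
move=> Qdiv mG /andP[j0 jk]; set S := [set _ | _].
have [->|/set0Pn[f0]] := eqVneq S set0; first by exists 0; rewrite cards0.
rewrite inE => /and3P[f0k _ Gf0].
have k0 : (0 < k)%N by lia.
have szG : size G = (size G).-1.+1 by rewrite prednK // size_poly_gt0 monic_neq0.
set j := (size G).-1 in j0 jk szG *.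
exists ((val f0 %/ G)`_(k - j).-1).
have div (f : {poly F}) : top_coefs k tau f -> G %| f ->
    [/\ f %/ G \is monic, size (f %/ G) = (k - j).+1 & (f %/ G) * G = f].
  move=> /and3P[mf /eqP sf _] Gf; have E := divpK Gf.
  have mh : f %/ G \is monic by rewrite -(monicMr _ mG) E.
  split=> //; have := size_Mmonic (monic_neq0 mh) mG.
  by rewrite E sf szG; lia.
rewrite -(card_in_imset (f := fun f : {poly_N F} => npolyp N (val f %/ G))).
  apply/subset_leq_card/subsetP => _ /imsetP[f + ->]; rewrite !inE.
  move=> /and3P[fk Qf Gf]; have [mh sh E] := div _ fk Gf.
  have sf := size_npoly f.
  rewrite npolypK; last first.
    by apply: leq_trans sf; have /and3P[_ /eqP -> _] := fk; rewrite sh; lia.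
  rewrite /top_coefs mh sh eqxx /=; apply/andP; split; last by apply: (Qdiv G); rewrite E.
  have [mh0 sh0 E0] := div _ f0k Gf0.
  rewrite -subr_eq0 -coefB; apply/eqP.
  have [->|nz] := eqVneq (val f %/ G - val f0 %/ G) 0; first by rewrite coef0.
  apply: nth_default.
  have := top_coefs_sub k0 fk f0k.
  have -> : val f - val f0 = (val f %/ G - val f0 %/ G) * G by rewrite mulrBl E E0.
  rewrite size_Mmonic // szG.
  have le s : ((s + j.+1).-1 <= k.-1)%N -> (s <= (k - j).-1)%N by lia.
  exact: le.
move=> f g; rewrite !inE => /and3P[fk Qf Gf] /and3P[gk Qg Gg] /(congr1 val) /=.
have [mh sh E] := div _ fk Gf; have [mh' sh' E'] := div _ gk Gg.
have szN : ((k - j).+1 <= N)%N.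
  by apply: leq_trans (size_npoly f); have /and3P[_ /eqP -> _] := fk; lia.
rewrite !(@npolypK _ N) ?sh ?sh' // => EE; apply: val_inj.
by rewrite /= -E -E' EE.
Qed.

(** Bounding prime powers, not only primes, keeps the degree of each divisor [P ^+ i] removed in the
    recursion at most [J]. *)
Definition power_smooth J f : bool :=
  `[< forall P i, monic_irred P -> P ^+ i %| f -> (i * (size P).-1 <= J)%N >].

Lemma power_smooth_div J f h : power_smooth J (h * f) -> power_smooth J h.
Proof.
move=> /asboolP H; apply/asboolP => P i iP Pi; apply: H => //.
exact: dvdp_trans Pi (dvdp_mulr _ (dvdpp _)).
Qed.

Definition power_divides J (p : {poly_J.+1 F} * 'I_J.+1) f : bool :=
  [&& monic_irred (val p.1), (0 < p.2)%N & val p.1 ^+ p.2 %| f].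

(** The weight [deg P] of [P ^+ i] is the von Mangoldt function of polynomials, whose sum over the
    divisors of [f] is the degree of [f]. Dividing [f] by [P] removes just the highest power of [P]
    from the sum. *)
Lemma degree_le_sum_powers J f : f \is monic -> power_smooth J f ->
  ((size f).-1 <= \sum_(p | power_divides (J := J) p f) (size (val p.1)).-1)%N.
Proof.
have [m] := ubnP (size f); elim: m f => // m IH f sf mf smf.
have [f1|f1] := leqP (size f) 1; first by move: f1; case: (size f) => [|[]].
have [P iP Pf] := monic_factor mf f1.
have P1 := monic_irred_size iP; have /monic_irredP[mP _] := iP.
pose f' := f %/ P; have E : f' * P = f by apply: divpK.
have mf' : f' \is monic by rewrite -(monicMr _ mP) E.
have sf' : (size f).-1 = ((size f').-1 + (size P).-1)%N.
  rewrite -E size_Mmonic ?monic_neq0 //.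
  have f'0 : (0 < size f')%N by rewrite size_poly_gt0 monic_neq0.
  have e a b : (0 < a)%N -> (1 < b)%N -> ((a + b).-2 = a.-1 + b.-1)%N by lia.
  exact: e.
have smf' : power_smooth J f' by apply: (@power_smooth_div _ P); rewrite E.
have f'f : (size f' < m)%N.
  have f'0 : (0 < size f')%N by rewrite size_poly_gt0 monic_neq0.
  by move: sf'; clear -f'0 P1 sf; lia.
have {}IH := IH f' f'f mf' smf'.
have [a aP amin] : exists2 a, P ^+ a %| f' & ~~ (P ^+ a.+1 %| f').
  have ex : exists a, ~~ (P ^+ a %| f').
    exists (size f'); apply/negP => /(dvdp_leq (monic_neq0 mf')).
    have f'0 : (0 < size f')%N by rewrite size_poly_gt0 monic_neq0.
    have e a b c : (0 < b)%N -> (1 < c)%N -> a.-1 = (c.-1 * b)%N -> (a <= b)%N -> False.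
      by case: c => [|[|c]] //=; rewrite mulSn; lia.
    exact: e f'0 P1 (size_exp P (size f')).
  case: (ex_minnP ex) => [[|a]]; first by rewrite expr0 dvd1p.
  move=> na mina; exists a => //; apply: contraT => /mina; by rewrite ltnn.
have /asboolP/(_ P a.+1 iP) sm := smf.
have aJ : (a.+1 * (size P).-1 <= J)%N.
  by apply: sm; rewrite exprSr -E dvdp_mul.
have szPJ' : ((size P).-1 <= J)%N by apply: leq_trans (leq_pmull _ (ltn0Sn a)) aJ.
have szPJ : (size P <= J.+1)%N by clear -szPJ'; lia.
have aJ' : (a.+1 < J.+1)%N.
  rewrite ltnS; apply: leq_trans aJ; apply: leq_pmulr; by clear -P1; lia.
pose p0 : {poly_J.+1 F} * 'I_J.+1 := (npolyp _ P, Ordinal aJ').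
rewrite sf' (bigD1 p0) /=; last first.
  rewrite /power_divides /= npolypK // iP /= -E exprSr.
  by rewrite dvdp_mul.
rewrite npolypK // addnC leq_add2l; apply: leq_trans IH _.
rewrite [leqRHS]big_mkcond /= big_mkcond /=; apply: leq_sum => p _.
case: ifP => // /and3P[iq p20 qf'].
rewrite /power_divides iq p20 /= -E dvdp_mulr //=.
case: eqP => // pE; move: qf'; rewrite pE /= npolypK // => H.
by rewrite H in amin.
Qed.
End PolyCount.

Lemma leq_exp_base e a b : (a <= b)%N -> (a ^ e <= b ^ e)%N.
Proof. by move=> ab; elim: e => // e IH; rewrite !expnS leq_mul. Qed.

(** * Smooth polynomials *)

Section Smooth.
Variables (F : finFieldType) (K : closedFieldType) (fK : {rmorphism F -> K}).
Local Notation q := #|F|.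
Local Notation fr := (frob fK).
Implicit Types (P Q f g h G : {poly F}).

Let q0 : (0 < q)%N. Proof. exact: ltnW (finNzRing_gt1 F). Qed.

Lemma monic_irred_root P : monic_irred P -> exists lam, root (map_poly fK P) lam.
Proof.
move=> iP; apply/closed_rootP; rewrite size_map_poly.
by have := monic_irred_size iP; case: (size P) => [|[]].
Qed.

Lemma monic_irred_dvd_Xq P j : monic_irred P -> ((size P).-1 %| j)%N ->
  P %| 'X^(q ^ j) - 'X.
Proof.
move=> iP /dvdnP[m ->]; have [lam rl] := monic_irred_root iP.
have /monic_irredP[mP irP] := iP.
apply: (irreducible_dvdp irP rl).
rewrite rmorphB /= map_polyXn map_polyX rootE !hornerE -(iter_frobE fK) subr_eq0.
elim: m => //= m IH; rewrite mulSn iterD (eqP IH).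
by rewrite (iter_frob_root irP mP rl).
Qed.

(** The polynomials concerned are pairwise coprime divisors of ['X^(q ^ j) - 'X], so their product
    divides it as well. *)
Lemma sum_degree_irred N j : (0 < j)%N ->
  (\sum_(P : {poly_N F} | monic_irred (val P) && ((size (val P)).-1 %| j)%N) (size (val P)).-1
    <= q ^ j)%N.
Proof.
move=> j0; rewrite -big_filter; set s := [seq _ <- _ | _].
pose t := map val s.
have tP P : P \in t -> monic_irred P /\ ((size P).-1 %| j)%N.
  by move=> /mapP[p]; rewrite mem_filter => /andP[/andP[? ?] _] ->.
have ut : uniq t by rewrite map_inj_uniq ?filter_uniq ?index_enum_uniq //; exact: val_inj.
have allirr : all (@monic_irred F) t by apply/allP => P /tP[].
have := prod_monic_irred_dvdp ut allirr (fun P Pt => monic_irred_dvd_Xq (tP P Pt).1 (tP P Pt).2).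
have qj : (1 < q ^ j)%N by rewrite -[1%N in ltnLHS](expn0 q) ltn_exp2l ?finNzRing_gt1.
have szX : size ('X^(q ^ j) - 'X : {poly F}) = (q ^ j).+1.
  by rewrite size_polyDl ?size_polyXn // size_polyN size_polyX ltnS.
have nzX : 'X^(q ^ j) - 'X != 0 :> {poly F} by rewrite -size_poly_eq0 szX.
move/(dvdp_leq nzX); rewrite szX size_prod_monic; last first.
  by apply/allP => P /tP[/monic_irredP[]].
by rewrite ltnS big_map.
Qed.

Lemma sum_degree_irred_pairs J j : (0 < j)%N ->
  (\sum_(p : {poly_J.+1 F} * 'I_J.+1 | [&& monic_irred (val p.1), (0 < p.2)%N &
      p.2 * (size (val p.1)).-1 == j]) (size (val p.1)).-1 <= q ^ j)%N.
Proof.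
move=> j0; apply: leq_trans (sum_degree_irred J.+1 j0).
rewrite [leqRHS]big_mkcond /= [leqLHS]big_mkcond /=.
rewrite -(pair_bigA _ (fun (P : {poly_J.+1 F}) (i : 'I_J.+1) =>
   if [&& monic_irred (val P), (0 < i)%N & (i * (size (val P)).-1)%N == j]
   then (size (val P)).-1 else 0%N)) /=.
apply: leq_sum => P _.
have [iP|niP] := boolP (monic_irred (val P)); last by rewrite big1.
have [[i0 i0P]|H] := pselect (exists i : 'I_J.+1, i * (size (val P)).-1 = j)%N; last first.
  rewrite big1 // => i _; case: ifP => // /and3P[_ _ /eqP E]; by case: H; exists i.
rewrite -i0P dvdn_mull ?dvdnn // (bigD1 i0) //= big1 ?addn0; first by case: ifP.
move=> i ii0; case: ifP => // /andP[_]; rewrite eqn_mul2r => /orP[/eqP -> //|/eqP/val_inj E].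
by rewrite E eqxx in ii0.
Qed.

(* Double counting of the prime powers [P ^+ i] dividing [f], weighted by the
   degree of [P]: the weights attached to a given [f] add up to its degree [k],
   while all the weights with [i * deg P = j] add up to at most [q ^ j]. *)
Lemma card_power_smooth N J r k tau : (r * J < k)%N ->
  (#|[set f : {poly_N F} | top_coefs k tau (val f) && power_smooth J (val f)]| * (k - r * J) ^ r
    <= q ^ k.-1 * J ^ r)%N.
Proof.
elim: r k tau => [|r IH] k tau rk.
  rewrite !expn0 !muln1; apply: leq_trans (card_top_coefs N tau _) => //.
  by apply/subset_leq_card/subsetP => f; rewrite !inE => /andP[].
have k0 : (0 < k)%N by apply: leq_ltn_trans rk.
set S := [set f : {poly_N F} | _].
set X := (k - r.+1 * J)%N.
have kX : (X <= k)%N by apply: leq_subr.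
pose deg (p : {poly_J.+1 F} * 'I_J.+1) := (p.2 * (size (val p.1)).-1)%N.
pose valid (p : {poly_J.+1 F} * 'I_J.+1) := monic_irred (val p.1) && (0 < p.2)%N.
have step1 : (k * #|S| <= \sum_(p | valid p && (deg p <= J)%N)
   (size (val p.1)).-1 * #|[set f in S | (val p.1 ^+ p.2 %| val f)%R]|)%N.
  rewrite mulnC -sum_nat_const.
  apply: (@leq_trans (\sum_(f in S) \sum_(p | power_divides (J := J) p (val f)) (size (val p.1)).-1)%N).
    apply: leq_sum => f; rewrite inE => /andP[/and3P[mf /eqP sf _] smf].
    by have := degree_le_sum_powers mf smf; rewrite sf.
  rewrite (exchange_big_dep (fun p => valid p && (deg p <= J)%N)) /=; last first.
    move=> f p; rewrite inE => /andP[_ /asboolP sm] /and3P[iP p0 pf].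
    by rewrite /valid iP p0 /=; apply: sm.
  apply: leq_sum => p /andP[/andP[iP p0] _].
  rewrite sum_nat_const mulnC leq_mul2l; apply/orP; right.
  apply/subset_leq_card/subsetP => f.
  by rewrite unfold_in => /andP[fS /and3P[_ _ pf]]; rewrite inE fS.
(* The quotient by a prime power is again power smooth, with prescribed subleading coefficient and
   degree [k - deg p]. As [deg p <= J], the base in its induction hypothesis is at least [X]. *)
have step2 p : valid p -> (deg p <= J)%N ->
    (#|[set f in S | (val p.1 ^+ p.2 %| val f)%R]| * X ^ r <= q ^ (k - deg p).-1 * J ^ r)%N.
  move=> /andP[iP p0] dJ.
  have P1 := monic_irred_size iP; have /monic_irredP[mP _] := iP.
  have szG : (size (val p.1 ^+ p.2)).-1 = deg p by rewrite size_exp mulnC.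
  have dp0 : (0 < deg p)%N by rewrite /deg muln_gt0 p0; case: (size _) P1 => [|[]].
  have dpk : (deg p < k)%N.
    by apply: leq_ltn_trans dJ (leq_ltn_trans _ rk); rewrite mulSn leq_addr.
  have mG : val p.1 ^+ p.2 \is monic by apply: monic_exp.
  have [|tau' H] := @card_top_coefs_dvd F N k tau _ (power_smooth J) (@power_smooth_div F J) mG.
    by rewrite szG dp0.
  rewrite szG in H.
  have {}H : (#|[set f in S | (val p.1 ^+ p.2 %| val f)%R]| <=
     #|[set h : {poly_N F} | top_coefs (k - deg p) tau' (val h) && power_smooth J (val h)]|)%N.
    apply: leq_trans H; apply/subset_leq_card/subsetP => f; rewrite !inE.
    by move=> /andP[/andP[-> ->] ->].
  have rk' : (r * J < k - deg p)%N by move: rk dJ; rewrite mulSn; lia.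
  apply: leq_trans (IH _ tau' rk'); apply: leq_mul => //.
  by apply: leq_exp_base; rewrite /X mulSn; lia.
have step3 : (\sum_(p | valid p && (deg p <= J)%N) (size (val p.1)).-1 * q ^ (k - deg p).-1
     <= J * q ^ k.-1)%N.
  rewrite (partition_big (fun p => inord (deg p) : 'I_J.+1) xpredT) //=.
  rewrite big_ord_recl /= big1 ?add0n; last first.
    move=> p /andP[/andP[/andP[iP p0] dJ] /eqP/(congr1 val)].
    rewrite /= inordK // => dp0; have := monic_irred_size iP.
    move: dp0; rewrite /deg => /eqP; rewrite muln_eq0 (gtn_eqF p0) /= => /eqP ->.
    by rewrite mul0n.
  rewrite -[X in (_ <= X * _)%N]card_ord -sum_nat_const; apply: leq_sum => j _.
  have jJ := ltn_ord j.
  apply: (@leq_trans (\sum_(p : {poly_J.+1 F} * 'I_J.+1 | [&& monic_irred (val p.1), (0 < p.2)%N & deg p == j.+1])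
      (size (val p.1)).-1 * q ^ (k - j.+1).-1)%N).
    rewrite big_mkcond [leqRHS]big_mkcond /=; apply: leq_sum => p _.
    case: ifP => // /andP[/andP[/andP[iP p0] dJ] /eqP/(congr1 val)].
    by rewrite /= inordK // => ->; rewrite iP p0 eqxx.
  rewrite -big_distrl /=; apply: leq_trans (leq_mul (sum_degree_irred_pairs J (ltn0Sn j)) (leqnn _)) _.
  by rewrite -expnD leq_pexp2l //; move: rk; rewrite mulSn; lia.
apply: (@leq_trans (k * #|S| * X ^ r)%N).
  by rewrite expnS mulnCA mulnA leq_mul2r leq_mul2r kX !orbT.
apply: leq_trans (leq_mul step1 (leqnn _)) _.
rewrite big_distrl /=.
apply: (@leq_trans (\sum_(p | valid p && (deg p <= J)%N)
   (size (val p.1)).-1 * q ^ (k - deg p).-1 * J ^ r)%N).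
  apply: leq_sum => p /andP[vp dJ]; rewrite -!mulnA leq_mul2l; apply/orP; right.
  exact: step2.
rewrite -big_distrl /=; apply: leq_trans (leq_mul step3 (leqnn _)) _.
by rewrite expnS mulnA [(J * _)%N]mulnC.
Qed.

(** The least [i] with [i * deg P > J] exceeds [J] in degree by at most [D]. So some [P ^+ i] of
    degree in [(J, J + D]] divides [f]; there are at most [q ^ D * (J + D).+1] of them, each fixing
    more than [J] coefficients. *)
Lemma card_small_power N J D k tau : (J + D < k)%N ->
  (#|[set f : {poly_N F} | top_coefs k tau (val f) &&
     `[< exists P i, [/\ monic_irred P, (size P <= D)%N, (P ^+ i %| val f)%R &
          (J < i * (size P).-1)%N] >]]| <= (q ^ D * (J + D).+1) * q ^ (k - J.+2))%N.
Proof.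
move=> JDk; set S := [set _ | _].
pose B (p : {poly_D F} * 'I_(J + D).+1) : {set {poly_N F}} :=
  [set f : {poly_N F} | [&& top_coefs k tau (val f), (val p.1 ^+ p.2 %| val f)%R,
     monic_irred (val p.1) & (J < p.2 * (size (val p.1)).-1 <= J + D)%N]].
apply: (@leq_trans (\sum_p #|B p|)%N).
  apply: leq_card_bigcup => f; rewrite inE => /andP[fk /asboolP[P [i [iP sP Pf Ji]]]].
  have P1 := monic_irred_size iP.
  have ex : exists i, (J < i * (size P).-1)%N by exists i.
  case: (ex_minnP ex) => i1 i1J i1min.
  have i1i := i1min _ Ji.
  have i1JD : (i1 * (size P).-1 <= J + D)%N.
    have i10 : (0 < i1)%N by case: (i1) i1J.
    have : ~~ (J < i1.-1 * (size P).-1)%N.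
      by apply/negP => /i1min; rewrite leqNgt prednK // leqnn.
    rewrite -leqNgt; rewrite -{2}(prednK i10) mulSn => H.
    by rewrite addnC leq_add //; apply: leq_trans sP; apply: leq_pred.
  have i1JD' : (i1 < (J + D).+1)%N.
    by rewrite ltnS; apply: leq_trans i1JD; apply: leq_pmulr; case: (size P) P1 => [|[]].
  exists (npolyp D P, Ordinal i1JD'); rewrite inE /= npolypK // fk iP i1J i1JD /= andbT.
  by apply: dvdp_trans Pf; apply: dvdp_exp2l.
rewrite -card_npoly -[X in (_ * X * _)%N]card_ord -card_prod -sum_nat_const; apply: leq_sum => p _.
have [iP|niP] := boolP (monic_irred (val p.1)); last first.
  by rewrite eq_card0 // => f; rewrite !inE (negPf niP) !andbF.
have [/andP[Jp pJD]|np] := boolP (J < p.2 * (size (val p.1)).-1 <= J + D)%N; last first.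
  by rewrite eq_card0 // => f; rewrite !inE (negPf np) !andbF.
have /monic_irredP[mP _] := iP.
have szG : (size (val p.1 ^+ p.2)).-1 = (p.2 * (size (val p.1)).-1)%N by rewrite size_exp mulnC.
have [//||tau' H] := @card_top_coefs_dvd F N k tau _ xpredT _ (monic_exp p.2 mP).
  rewrite szG (leq_ltn_trans pJD JDk) andbT; exact: leq_ltn_trans Jp.
rewrite szG in H.
apply: leq_trans (_ : _ <= q ^ (k - p.2 * (size (val p.1)).-1).-1)%N _; last first.
  by rewrite leq_pexp2l //; lia.
have kj : (0 < k - p.2 * (size (val p.1)).-1)%N by rewrite subn_gt0 (leq_ltn_trans pJD).
apply: leq_trans (card_top_coefs N tau' kj); apply: leq_trans (leq_trans H _).
  by apply/subset_leq_card/subsetP => f; rewrite !inE => /and4P[-> -> _ _].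
by apply/subset_leq_card/subsetP => f; rewrite !inE => /andP[->].
Qed.

End Smooth.

(** * Polynomials whose differences of roots are not isolated *)

(** Of the five shifts [0, c, ..., 4 * c], each of the four exponents excludes at most one, as the
    residues above [d - c] lie within a distance less than [c]. Unrotated, an exponent [d - 1] could
    occur, and the saving of a single factor [q] would not make up for the number of pairs of
    roots. *)
Lemma rotation_window d c (i j : nat) : (0 < c)%N -> (5 * c <= d)%N -> (i < d)%N -> (j < d)%N ->
  exists t, forall e, e \in [:: 0%N; 1%N; i; j] -> ((e + t) %% d <= d - c)%N.
Proof.
move=> c0 cd id jd.
pose bad e := [set m : 'I_5 | (d - c < (e + m * c) %% d)%N].
have bad1 e : (e < d)%N -> (#|bad e| <= 1)%N.
  move=> ed; apply/card_le1P => m; rewrite inE => bm m'; rewrite !inE.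
  apply/idP/eqP => [bm'|-> //].
  wlog lt : m m' bm bm' / (m <= m')%N.
    by move=> H; case: (leqP m m') => [/H->//|/ltnW/H->].
  apply/eqP; rewrite eq_sym; apply/eqP/val_inj/eqP; rewrite eqn_leq lt leqNgt /=.
  apply/negP => mm'.
  have m5 := ltn_ord m; have m'5 := ltn_ord m'.
  have cm : (c <= (m' - m) * c)%N by rewrite leq_pmull // subn_gt0.
  have cm' : ((m' - m) * c <= 4 * c)%N by rewrite leq_mul2r; lia.
  have E : ((e + m' * c) %% d = (((e + m * c) %% d) + (m' - m) * c) %% d)%N.
    by rewrite modnDml -addnA -mulnDl subnKC.
  move: bm bm'; rewrite E; set a := ((e + m * c) %% d)%N => a1.
  have ad : (a < d)%N by rewrite ltn_mod; lia.
  have -> : (a + (m' - m) * c = (a + (m' - m) * c - d) + d)%N by lia.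
  by rewrite modnDr modn_small; lia.
have H : (#|bad 0%N :|: bad 1%N :|: (bad i :|: bad j)| < 5)%N.
  have d1 : (1 < d)%N by lia.
  have := bad1 0%N (ltnW d1); have := bad1 1%N d1; have := bad1 i id; have := bad1 j jd.
  have := cardsU (bad 0%N :|: bad 1%N) (bad i :|: bad j).
  have := cardsU (bad 0%N) (bad 1%N); have := cardsU (bad i) (bad j).
  lia.
have [m mP] : exists m : 'I_5, m \notin bad 0%N :|: bad 1%N :|: (bad i :|: bad j).
  apply/existsP; rewrite -negb_forall; apply: contraTN H => /forallP H.
  rewrite -leqNgt -[leqLHS](card_ord 5); apply/subset_leq_card/subsetP => m _; exact: H.
exists (m * c)%N => e; move: mP; rewrite !inE !negb_or -!leqNgt.
move=> /andP[/andP[? ?] /andP[? ?]].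
by move=> /or4P[] /eqP ->.
Qed.

Lemma card_roots_cover (T I : finType) (K : fieldType) (S : {set T}) (x : T -> K)
    (Om : I -> {poly K}) (M : I -> nat) :
  {in S &, injective x} -> (forall p, p \in S -> exists i, root (Om i) (x p)) ->
  (forall i, Om i != 0) -> (forall i, size (Om i) <= (M i).+1)%N ->
  (#|S| <= \sum_i M i)%N.
Proof.
move=> xinj cover nz sz.
apply: (@leq_trans (\sum_i #|[set p in S | root (Om i) (x p)]|)%N).
  by apply: leq_card_bigcup => p pS; have [i ri] := cover p pS; exists i; rewrite inE pS.
apply: leq_sum => i _; rewrite -ltnS; apply: leq_trans (sz i).
rewrite cardE -(size_map x); apply: max_poly_roots => //.
  by apply/allP => _ /mapP[p + ->]; rewrite mem_enum inE => /andP[].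
rewrite map_inj_in_uniq ?enum_uniq // => p p'.
by rewrite !mem_enum !inE => /andP[pS _] /andP[p'S _]; apply: xinj.
Qed.

Lemma odd_card_two_neq0 (F : finFieldType) : odd #|F| -> (2%:R : F) != 0.
Proof.
move=> oddq; apply/negP => two0.
have p2 : 2%N \in [pchar F] by rewrite inE /= two0.
have := pprimeChar_pgroup p2; rewrite /pgroup cardsT => /p_natP[k qk].
by move: oddq (finNzRing_gt1 F); rewrite qk oddX orbF => /eqP ->.
Qed.

Section BadPairs.
Variables (F : finFieldType) (K : closedFieldType) (fK : {rmorphism F -> K}).
Local Notation q := #|F|.
Local Notation fr := (frob fK).
Implicit Types (P Q f g h G : {poly F}).

Definition isolated_pair (chi : {poly F}) (lam : K) : Prop :=
  forall r s, root (map_poly fK chi) r -> root (map_poly fK chi) s ->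
    r - s = lam - fr lam -> r = lam /\ s = fr lam.

Definition good_root P G (lam : K) : Prop :=
  ~~ root (map_poly fK G) lam /\ isolated_pair (P * G) lam.

Lemma iter_frob_mod d (lam : K) a : iter d fr lam = lam ->
  iter (a %% d) fr lam = iter a fr lam.
Proof.
move=> Ed; rewrite {2}(divn_eq a d) addnC iterD; congr (iter _ _ _).
by elim: (a %/ d)%N => //= m IH; rewrite mulSn iterD -IH.
Qed.

Lemma iter_frobB t (x y : K) : iter t fr (x - y) = iter t fr x - iter t fr y.
Proof. by elim: t => //= t ->; rewrite rmorphB. Qed.

Section Count.
Variables (G : {poly F}) (d c m : nat) (R : seq K).
Hypotheses (oddq : odd q) (c0 : (0 < c)%N) (cd : (5 * c <= d)%N).
Hypothesis GR : map_poly fK G = \prod_(z <- R) ('X - z%:P).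
Hypothesis szR : size R = m.

Local Notation slot := ('I_d + 'I_m)%type.

(* A root of [P * G] is either a conjugate [lam ^ (q ^ i)] of the root [lam] of
   [P] (slot [inl i]) or one of the roots [R] of [G] (slot [inr r]). *)
Definition slot_index (s : slot) : nat := if s is inl i then i else 0.

Let slot_index_lt s : (slot_index s < d)%N.
Proof. by case: s => [i|r] //=; clear -c0 cd; lia. Qed.

Definition slot_rot (s t : slot) : nat :=
  projT1 (cid (rotation_window c0 cd (slot_index_lt s) (slot_index_lt t))).

Lemma slot_rotP s t e : e \in [:: 0%N; 1%N; slot_index s; slot_index t] ->
  ((e + slot_rot s t) %% d <= d - c)%N.
Proof. by rewrite /slot_rot; case: cid => tau H /=; apply: H. Qed.

Definition slot_value (lam : K) (s : slot) : K :=
  match s with inl i => iter i fr lam | inr r => R`_r end.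

Definition slot_poly (tau : nat) (s : slot) : {poly K} :=
  match s with inl i => 'X^(q ^ ((i + tau) %% d)) | inr r => (iter tau fr R`_r)%:P end.

(* The equation [lam - lam ^ q = r - s], to which Frobenius has been applied
   [tau] times.  The rotation [tau] keeps all the exponents [q ^ e] at most
   [q ^ (d - c)], so that the equation has few solutions [lam]. *)
Definition pair_poly (s t : slot) : {poly K} :=
  let tau := slot_rot s t in
  'X^(q ^ ((0 + tau) %% d)) - 'X^(q ^ ((1 + tau) %% d)) - slot_poly tau s + slot_poly tau t.

Let d1 : (1 < d)%N. Proof. by clear -c0 cd; lia. Qed.
Let q1 : (1 < q)%N. Proof. exact: finNzRing_gt1. Qed.

Let zero_slot : slot := inl (Ordinal (ltnW d1)).
Let one_slot : slot := inl (Ordinal d1).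

Lemma slot_poly_value tau lam s : iter d fr lam = lam ->
  (slot_poly tau s).[lam] = iter tau fr (slot_value lam s).
Proof.
move=> Ed; case: s => [i|r] /=; last by rewrite hornerC.
by rewrite hornerXn -(iter_frobE fK) iter_frob_mod // addnC iterD.
Qed.

Lemma pair_poly_root lam s t : iter d fr lam = lam ->
  slot_value lam s - slot_value lam t = lam - fr lam -> root (pair_poly s t) lam.
Proof.
move=> Ed st; rewrite rootE /pair_poly !(hornerD, hornerN) !slot_poly_value //.
rewrite !hornerXn -!(iter_frobE fK) !iter_frob_mod // add0n add1n iterSr -iter_frobB.
by rewrite -st iter_frobB addrAC subrK subrr.
Qed.

Let modD_inj tau a b : (a < d)%N -> (b < d)%N -> ((a + tau) %% d == (b + tau) %% d)%N = (a == b).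
Proof. by move=> ad bd; rewrite eqn_modDr !modn_small. Qed.

Lemma slot_poly_coef tau (s : slot) (i : 'I_d) :
  (slot_poly tau s)`_(q ^ ((i + tau) %% d)) = (s == inl i)%:R.
Proof.
case: s => [j|r] /=.
  by rewrite coefXn eqn_exp2l // modD_inj // eq_sym.
by rewrite coefC expn_eq0 -leqn0 leqNgt (ltnW q1).
Qed.

(** One monomial of [lam - lam ^ q] survives, with coefficient 1, -1 or -2. The value -2 occurs for
    [s = one_slot], and this requires odd characteristic. *)
Lemma pair_poly_neq0 s t : (s, t) != (zero_slot, one_slot) -> pair_poly s t != 0.
Proof.
move=> st; have two : (2%:R : K) != 0.
  by rewrite -(rmorph_nat fK) fmorph_eq0 odd_card_two_neq0.
have neg : (-1 - 1 : K) != 0 by rewrite -opprD oppr_eq0.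
have one : (1 : K) != 0 by apply: oner_neq0.
apply/eqP => /polyP E; set tau := slot_rot s t in E.
have [t1|t1] := eqVneq t one_slot.
  have s0 : s != zero_slot by apply: contraNneq st => ->; rewrite t1.
  have := E (q ^ ((0 + tau) %% d))%N; rewrite /pair_poly -/tau.
  rewrite !(coefD, coefN) (slot_poly_coef tau s (Ordinal (ltnW d1))).
  rewrite (slot_poly_coef tau t (Ordinal (ltnW d1))) !coefXn eqxx.
  rewrite eqn_exp2l // modD_inj ?(ltnW d1) // (negPf s0) t1 coef0.
  rewrite (_ : one_slot == _ = false) // !subr0 addr0 => /eqP; by rewrite (negPf one).
have := E (q ^ ((1 + tau) %% d))%N; rewrite /pair_poly -/tau.
rewrite !(coefD, coefN) (slot_poly_coef tau s (Ordinal d1)) (slot_poly_coef tau t (Ordinal d1)).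
rewrite !coefXn eqxx eqn_exp2l // modD_inj ?(ltnW d1) // (negPf t1) coef0 add0r addr0.
case: (s == _) => /eqP; first by rewrite (negPf neg).
by rewrite subr0 oppr_eq0 (negPf one).
Qed.

Lemma size_pair_poly s t : (size (pair_poly s t) <= (q ^ (d - c)).+1)%N.
Proof.
have szX e : e \in [:: 0%N; 1%N; slot_index s; slot_index t] ->
    (size ('X^(q ^ ((e + slot_rot s t) %% d)) : {poly K}) <= (q ^ (d - c)).+1)%N.
  by move=> /slot_rotP H; rewrite size_polyXn ltnS leq_pexp2l // ltnW.
have szS (r : slot) : slot_index r \in [:: 0%N; 1%N; slot_index s; slot_index t] ->
    (size (slot_poly (slot_rot s t) r) <= (q ^ (d - c)).+1)%N.
  case: r => [i|r] /= H; first exact: szX.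
  by apply: leq_trans (size_polyC_leq1 _) _.
rewrite /pair_poly; apply: leq_trans (size_polyD _ _) _; rewrite geq_max szS ?andbT; last first.
  by rewrite !inE eqxx !orbT.
apply: leq_trans (size_polyD _ _) _; rewrite geq_max size_polyN szS ?andbT; last first.
  by rewrite !inE eqxx !orbT.
apply: leq_trans (size_polyD _ _) _; rewrite geq_max size_polyN.
by rewrite !szX // !inE.
Qed.

Lemma card_bad_irred N :
  (#|[set P : {poly_N F} | [&& monic_irred (val P), size (val P) == d.+1 &
     `[< exists2 lam, root (map_poly fK (val P)) lam & ~ good_root (val P) G lam >]]]|
   <= m + (d + m) ^ 2 * q ^ (d - c))%N.
Proof.
set S := [set _ | _].
have SP (P : {poly_N F}) : P \in S -> exists lam,
    [/\ monic_irred (val P), size (val P) = d.+1, root (map_poly fK (val P)) lam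
      & ~ good_root (val P) G lam].
  by rewrite inE => /and3P[iP /eqP sP /asboolP[lam rl ng]]; exists lam.
(* One bad root is chosen for each [P] in [S]; distinct irreducible polynomials share no root. The
   value 0 outside [S] is a dummy. *)
pose x (P : {poly_N F}) : K :=
  if pselect (P \in S) is left PS then projT1 (cid (SP P PS)) else 0.
have xP (P : {poly_N F}) : P \in S -> [/\ monic_irred (val P), size (val P) = d.+1,
     root (map_poly fK (val P)) (x P) & ~ good_root (val P) G (x P)].
  by rewrite /x; case: pselect => // PS _; case: cid.
have xinj : {in S &, injective x}.
  move=> P Q /xP[iP _ rP _] /xP[iQ _ rQ _] xPQ; apply: val_inj.
  apply/eqP; apply: contraT => PQ.
  have := monic_irred_coprime iP iQ PQ; rewrite -(coprimep_map fK).
  by move/coprimep_root/(_ rP); rewrite -rootE xPQ rQ.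
(* The pair of slots of [lam] and [lam ^ q] would give the zero polynomial; it is not a bad pair and
   receives a polynomial without roots. *)
pose Om (i : unit + slot * slot) : {poly K} :=
  match i with
  | inl _ => map_poly fK G
  | inr st => if st == (zero_slot, one_slot) then 1 else pair_poly st.1 st.2
  end.
pose M (i : unit + slot * slot) : nat := match i with inl _ => m | inr _ => (q ^ (d - c))%N end.
have := @card_roots_cover _ _ _ S x Om M xinj.
rewrite big_sumType /= big_const card_unit iter_addn_0 muln1 sum_nat_const.
rewrite card_prod card_sum !card_ord mulnn; apply.
- move=> P /xP[iP sP rP ng].
  have /monic_irredP[mP irP] := iP.
  have Ed : iter d fr (x P) = x P by have := iter_frob_root irP mP rP; rewrite sP.
  have [rG|nrG] := boolP (root (map_poly fK G) (x P)); first by exists (inl tt).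
  have [r [s [rr rs rsE nrs]]] : exists r s, [/\ root (map_poly fK (val P * G)) r,
     root (map_poly fK (val P * G)) s, r - s = x P - fr (x P) & ~ (r = x P /\ s = fr (x P))].
    apply: contrapT => H; apply: ng; split => // r s rr rs rsE.
    by apply: contrapT => nrs; apply: H; exists r, s.
  have slotP y : root (map_poly fK (val P * G)) y -> exists s, y = slot_value (x P) s.
    rewrite rmorphM rootM /= (irreducible_prod_frob irP mP rP) sP /= GR !root_prod_XsubC.
    move=> /orP[/mapP[i]|yR].
      by rewrite mem_iota => /andP[_ id] ->; exists (inl (Ordinal id)).
    have ys : (index y R < m)%N by rewrite -szR index_mem.
    by exists (inr (Ordinal ys)); rewrite /= nth_index.
  have [sl rsl] := slotP r rr; have [sl' ssl'] := slotP s rs.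
  exists (inr (sl, sl')); rewrite /=; case: eqP => [[E1 E2]|_].
    by case: nrs; rewrite rsl ssl' E1 E2.
  by apply: pair_poly_root => //; rewrite -rsl -ssl'.
- case=> [_|[s t]] /=; first by rewrite GR monic_neq0 // monic_prod_XsubC.
  by case: (eqVneq (s, t)) => [_|/pair_poly_neq0 //]; rewrite oner_neq0.
case=> [_|st] /=; first by rewrite GR size_prod_XsubC szR.
by case: eqP => _; [rewrite size_poly1 | exact: size_pair_poly].
Qed.
End Count.
End BadPairs.

(** * Polynomials without an isolated difference *)

Section Spectrum.
Variables (F : finFieldType) (K : closedFieldType) (fK : {rmorphism F -> K}).
Local Notation q := #|F|.
Local Notation fr := (frob fK).
Implicit Types (P Q f g h G : {poly F}).

Let q0 : (0 < q)%N. Proof. exact: ltnW (finNzRing_gt1 F). Qed.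

Definition isolated_spectrum D (chi : {poly F}) : Prop :=
  exists (lam : K) (d : nat) (rs : seq K),
  [/\ (D <= d)%N, iter d fr lam = lam,
      forall i j, (i < d)%N -> (j < d)%N -> iter i fr lam = iter j fr lam -> i = j,
      map_poly fK chi = \prod_(r <- [:: lam, fr lam & rs]) ('X - r%:P) &
      [/\ lam \notin rs, fr lam \notin rs & isolated_pair fK chi lam]].

Lemma monic_split (G : {poly F}) : G \is monic ->
  exists2 R : seq K, map_poly fK G = \prod_(z <- R) ('X - z%:P) & size R = (size G).-1.
Proof.
move=> mG; have [R E] := closed_field_poly_normal (map_poly fK G).
move: E; rewrite (eqP (monic_map fK mG)) scale1r => E; exists R => //.
by rewrite -(size_map_poly fK) E size_prod_XsubC.
Qed.

Lemma good_root_isolated D P G lam : (1 < D)%N -> (D <= (size P).-1)%N ->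
  monic_irred P -> G \is monic -> root (map_poly fK P) lam -> good_root fK P G lam ->
  isolated_spectrum D (P * G).
Proof.
move=> D1 Dd /monic_irredP[mP irP] mG rl [nG iso].
have [R GR szR] := monic_split mG.
set d := (size P).-1 in Dd *.
have inj := @iter_frob_inj F K fK P lam irP rl.
have Ed : iter d fr lam = lam by exact: iter_frob_root.
have d2 : (2 <= d)%N by apply: leq_trans Dd.
exists lam, d, ([seq iter i fr lam | i <- iota 2 (d - 2)] ++ R); split=> //.
  rewrite rmorphM /= (irreducible_prod_frob irP mP rl) GR -big_cat -/d /=.
  by rewrite -{1}(subnKC d2) iotaD.
have nR i : iter i fr lam \notin R.
  rewrite -root_prod_XsubC -GR; apply: contra nG.
  have lamE : iter (d - i %% d) fr (iter i fr lam) = lam.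
    rewrite -iterD -(iter_frob_mod _ Ed) -modnDmr subnK ?modnn //.
    by rewrite ltnW // ltn_mod (leq_trans _ d2).
  by move=> H; rewrite -lamE; exact: root_iter_frob.
split=> //; rewrite mem_cat negb_or.
  rewrite (nR 0%N) andbT; apply/mapP => -[i]; rewrite mem_iota => /andP[i2 id] E.
  have := inj 0%N i _ _ E; rewrite -/d.
  by move=> /(_ (leq_trans _ d2)) H; move: i2; rewrite -H //; lia.
rewrite (nR 1%N) andbT; apply/mapP => -[i]; rewrite mem_iota => /andP[i2 id] E.
have := inj 1%N i _ _ E; rewrite -/d => H; move: i2; rewrite -H //; lia.
Qed.

Section Count.
Variables (J D c r : nat) (oddq : odd q) (c0 : (0 < c)%N) (cD : (5 * c <= D)%N).

(** A bad [f0 - x] is power smooth, or divisible by a large power of an irreducible of degree below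
    [D], or a product [P * h] with [deg P >= D] where [P] has a bad root relative to [h * psi]. In
    the last case the choices of [h] and [P] together lose about [q ^ c]. The number of power smooth
    ones is passed on as [s], its bound being known in multiplied form. *)
Lemma card_bad_poly N f0 psi k m : f0 \is monic -> size f0 = k.+1 -> psi \is monic ->
  size psi = m.+1 -> (J + D < k)%N -> (r * J < k)%N -> (k < N)%N ->
  exists2 s, (s * (k - r * J) ^ r <= q ^ k.-1 * J ^ r)%N &
  (#|[set x : {poly_k.-1 F} | `[< ~ isolated_spectrum D ((f0 - val x) * psi) >]]| <=
   s + q ^ D * (J + D).+1 * q ^ (k - J.+2) + (k + m).+1 ^ 3 * q ^ (k - c).+1)%N.
Proof.
move=> mf0 sf0 mpsi spsi JDk rJk kN.
have k0 : (0 < k)%N by apply: leq_ltn_trans rJk.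
have D1 : (1 < D)%N by lia.
pose tau := f0`_k.-1.
have topx (x : {poly_k.-1 F}) : top_coefs k tau (f0 - val x).
  have sx : (size (val x) <= k.-1)%N by apply: size_npoly.
  have sx' : (size (- val x)%R < size f0)%N by rewrite size_polyN sf0 ltnS (leq_trans sx) // leq_pred.
  rewrite /top_coefs monicE lead_coefDl // (eqP mf0) size_polyDl // sf0 !eqxx /=.
  by rewrite coefB [(val x)`__]nth_default // subr0.
pose g (x : {poly_k.-1 F}) : {poly_N F} := npolyp N (f0 - val x).
have gE x : val (g x) = f0 - val x.
  by rewrite /g /= npolypK //; have /and3P[_ /eqP -> _] := topx x.
have ginj : injective g.
  by move=> x y /(congr1 val); rewrite !gE => /addrI/oppr_inj/val_inj.
pose S1 := [set f : {poly_N F} | top_coefs k tau (val f) && power_smooth J (val f)].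
pose S2 := [set f : {poly_N F} | top_coefs k tau (val f) &&
     `[< exists P i, [/\ monic_irred P, (size P <= D)%N, (P ^+ i %| val f)%R &
          (J < i * (size P).-1)%N] >]].
pose bad h d := [set P : {poly_N F} | [&& monic_irred (val P), size (val P) == d.+1 &
     `[< exists2 lam, root (map_poly fK (val P)) lam & ~ good_root fK (val P) (h * psi) lam >]]].
pose B (p : 'I_k.+1 * {poly_N F}) : {set {poly_N F}} :=
  if [&& (D <= p.1)%N, val p.2 \is monic & size (val p.2) == (k - p.1).+1]
  then [set npolyp N (val P * val p.2) | P in bad (val p.2) p.1] else set0.
pose S3 := \bigcup_p B p.
have cover : g @: [set x : {poly_k.-1 F} | `[< ~ isolated_spectrum D ((f0 - val x) * psi) >]]
    \subset S1 :|: S2 :|: S3.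
  apply/subsetP => _ /imsetP[x + ->]; rewrite inE => /asboolP nx.
  have := topx x; rewrite -gE in nx *; set f := g x in nx * => tf.
  rewrite !inE tf /=; have [//|/asboolPn nsm] := boolP (power_smooth J (val f)).
  have [P [i [iP Pf Ji]]] : exists P i, [/\ monic_irred P, P ^+ i %| val f & (J < i * (size P).-1)%N].
    apply: contrapT => H; apply: nsm => P i iP Pf; rewrite leqNgt; apply/negP => Ji.
    by apply: H; exists P, i.
  have [sP|sP] := leqP (size P) D.
    by apply/orP; left; apply/asboolP; exists P, i.
  apply/orP; right.
  have i0 : (0 < i)%N by case: (i) Ji.
  have {}Pf : P %| val f by apply: dvdp_trans Pf; rewrite -(prednK i0) exprS dvdp_mulr.
  have /monic_irredP[mP irP] := iP.
  pose h := val f %/ P; have E : h * P = val f by apply: divpK.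
  have /and3P[mf /eqP sf _] := tf.
  have mh : h \is monic by rewrite -(monicMr _ mP) E.
  have szP : size P = (size P).-1.+1 by rewrite prednK // size_poly_gt0 monic_neq0.
  have sh0 : (0 < size h)%N by rewrite size_poly_gt0 monic_neq0.
  have sE : (size h + (size P).-1 = k.+1)%N.
    by rewrite -sf -E size_Mmonic ?monic_neq0 // {2}szP addnS.
  set d := (size P).-1 in szP sE.
  have dk : (d < k.+1)%N by move: sE sh0; clear; lia.
  have sh : size h = (k - d).+1 by move: sE dk; clear; lia.
  have PN : npolyp N P = P :> {poly F} by rewrite npolypK // szP; clear -dk kN; lia.
  have hN : npolyp N h = h :> {poly F} by rewrite npolypK // sh; clear -kN; lia.
  apply/bigcupP; exists (Ordinal dk, npolyp N h) => //; rewrite /B /= hN mh sh eqxx.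
  have Dd : (D <= d)%N by move: sP; rewrite szP; clear; lia.
  rewrite Dd /=; apply/imsetP; exists (npolyp N P); last first.
    by rewrite PN mulrC E; apply: val_inj; rewrite [RHS]npolypK // sf.
  rewrite inE /= PN iP szP eqxx /=; apply/asboolP.
  have [lam rl] := monic_irred_root fK iP; exists lam => // gl; apply: nx.
  rewrite -E mulrAC mulrC; apply: (good_root_isolated D1 Dd iP _ rl).
    by rewrite monicMl.
  exact: gl.
exists #|S1|; first exact: (card_power_smooth fK).
rewrite -(card_imset _ ginj); apply: leq_trans (subset_leq_card cover) _.
have cardU (A C : {set {poly_N F}}) : (#|A :|: C| <= #|A| + #|C|)%N by rewrite cardsU leq_subr.
apply: leq_trans (cardU _ _) _; apply: leq_add.
  by apply: leq_trans (cardU _ _) _; rewrite leq_add2l; exact: card_small_power.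
apply: (@leq_trans (\sum_p #|B p|)%N); first by apply: leq_card_bigcup => f /bigcupP[p _ fp]; exists p.
have cardB p : (#|B p| <= if (D <= p.1)%N && (val p.2 \is monic) && (size (val p.2) == (k - p.1).+1)
     then (k + m).+1 ^ 2 * q ^ (p.1 - c).+1 else 0)%N.
  rewrite /B; case: ifP => [/and3P[Dp mh sh]|_]; last by rewrite cards0.
  rewrite Dp mh sh /=; apply: leq_trans (leq_imset_card _ _) _.
  have mG : val p.2 * psi \is monic by rewrite monicMl.
  have [R GR szR] := monic_split mG.
  have cp : (5 * c <= p.1)%N by apply: leq_trans Dp.
  apply: leq_trans (card_bad_irred oddq c0 cp GR erefl N) _.
  have szR' : size R = (k - p.1 + m)%N.
    by rewrite szR size_Mmonic ?monic_neq0 // (eqP sh) spsi addSn addnS.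
  have pk : (p.1 <= k)%N by rewrite -ltnS.
  rewrite szR' addnA subnKC //.
  have qp : (0 < q ^ (p.1 - c))%N by rewrite expn_gt0 q0.
  have le1 : (k - p.1 + m <= (k + m) * q ^ (p.1 - c))%N.
    by apply: leq_trans (leq_pmulr _ qp); rewrite leq_add2r leq_subr.
  apply: (@leq_trans ((k + m).+1 ^ 2 * q ^ (p.1 - c))%N).
    apply: leq_trans (leq_add le1 (leqnn _)) _; rewrite -mulnDl leq_mul2r; apply/orP; right.
    clear; nia.
  by rewrite leq_mul2l leq_pexp2l ?orbT.
apply: leq_trans; first (apply: leq_sum => p _; exact: (cardB p)).
rewrite -(pair_bigA _ (fun (d : 'I_k.+1) (h : {poly_N F}) =>
   if (D <= d)%N && (val h \is monic) && (size (val h) == (k - d).+1)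
     then ((k + m).+1 ^ 2 * q ^ (d - c).+1)%N else 0%N)) /=.
apply: (@leq_trans (\sum_(d < k.+1) (k + m).+1 ^ 2 * q ^ (k - c).+1)%N); last first.
  rewrite sum_nat_const card_ord mulnA [((k + m).+1 ^ 3)%N]expnS.
  by rewrite !leq_mul2r ltnS leq_addr !orbT.
apply: leq_sum => d _; have [Dd|_] := leqP D d; last by rewrite big1.
have dk : (d <= k)%N by rewrite -ltnS.
have cd : (c <= d)%N by apply: leq_trans Dd; apply: leq_trans cD; rewrite leq_pmull.
rewrite -big_mkcond /= sum_nat_const mulnCA leq_mul2l; apply/orP; right.
have -> : ((k - c).+1 = (k - d) + (d - c).+1)%N by clear -dk cd; lia.
rewrite expnD leq_mul2r; apply/orP; right.
apply: leq_trans (card_monic F N (k - d)); apply/subset_leq_card/subsetP => h.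
by rewrite unfold_in inE.
Qed.
End Count.
End Spectrum.

(** * Random matrices *)

Section BadMatrices.
Variables (F : finFieldType) (K : closedFieldType) (fK : {rmorphism F -> K}) (n' : nat).
Local Notation n := n'.+1.
Local Notation q := #|F|.
Local Notation fr := (frob fK).
Variables (J D c r M : nat).
Hypotheses (oddq : odd q) (c0 : (0 < c)%N) (cD : (5 * c <= D)%N) (J0 : (0 < J)%N) (M0 : (0 < M)%N).

Let q0 : (0 < q)%N. Proof. exact: ltnW (finNzRing_gt1 F). Qed.

Definition spectrum_ok (A : 'M[F]_n) := `[< isolated_spectrum fK D (char_poly A) >].

(* The translations [t x] in the proof fix the Krylov vectors of [w] and the cofactor [psi] of
   the characteristic polynomial, and subtract [x] from the other factor [f0]. *)
Lemma card_bad_krylov (w : 'rV[F]_n) j : (j < n)%N ->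
  (J + D < j.+1)%N -> (r * J < j.+1)%N -> (c < j.+1)%N ->
  (M * J ^ r <= (j.+1 - r * J) ^ r)%N ->
  (M * (q ^ D * (J + D).+1 * q ^ (j.+1 - J.+2)) <= q ^ j)%N ->
  (M * (n.+1 ^ 3 * q ^ (j.+1 - c).+1) <= q ^ j)%N ->
  (#|[set A in sl F n | (krylov_dim A w == j.+1) && ~~ spectrum_ok A]| * M <=
   3 * #|[set A in sl F n | krylov_dim A w == j.+1]|)%N.
Proof.
move=> jn JDj rJj cj H1 H2 H3.
pose S := [set A in sl F n | krylov_dim A w == j.+1].
pose t (x : {poly_j F}) (A : 'M[F]_n) := A + krylov_dual A w j *m krylov_comb A w j (val x).
have -> : [set A in sl F n | (krylov_dim A w == j.+1) && ~~ spectrum_ok A] =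
    [set A in S | ~~ spectrum_ok A] by apply/setP => A; rewrite !inE andbA.
have SP A : A \in S -> \tr A = 0 /\ krylov_dim A w = j.+1.
  by rewrite !inE => /andP[/eqP ? /eqP].
have qj0 : (0 < q ^ j)%N by rewrite expn_gt0 q0.
rewrite -(leq_pmul2r qj0).
have le A : A \in S -> (#|[set x : {poly_j F} | ~~ spectrum_ok (t x A)]| * M <= 3 * q ^ j)%N.
  move=> /SP[_ kA].
  have [f0 [psi [mf0 sf0 chi]]] := char_poly_krylov kA.
  have chi0 : char_poly (A + krylov_dual A w j *m krylov_comb A w j 0) = f0 * psi.
    by rewrite chi ?size_poly0 ?subr0.
  have mpsi : psi \is monic by rewrite -(monicMl _ mf0) -chi0 char_poly_monic.
  have spsi : size psi = (n - j.+1).+1.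
    have := size_char_poly (A + krylov_dual A w j *m krylov_comb A w j 0).
    rewrite chi0 mulrC size_Mmonic ?monic_neq0 // sf0 addnS /=.
    have e a : (a + j.+1 = n.+1)%N -> a = (n - j.+1).+1 by clear -jn; lia.
    exact: e.
  have [s sb] := @card_bad_poly F K fK J D c r oddq c0 cD j.+2 f0 psi j.+1 _ mf0 sf0 mpsi spsi
     JDj rJj (ltnSn _).
  rewrite subnKC // -[j.+1.-1]/j in sb *.
  move=> H.
  have -> : [set x : {poly_j F} | ~~ spectrum_ok (t x A)] =
     [set x : {poly_j F} | `[< ~ isolated_spectrum fK D ((f0 - val x) * psi) >]].
    apply/setP => x; rewrite !inE /spectrum_ok -asbool_neg /t chi //; exact: size_npoly.
  apply: leq_trans (leq_mul H (leqnn M)) _.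
  rewrite mulnC 2!mulnDr (_ : 3 * q ^ j = q ^ j + q ^ j + q ^ j)%N; last by rewrite !mulSn addn0 addnA.
  apply: leq_add H3; apply: leq_add H2.
  have Jr : (0 < J ^ r)%N by rewrite expn_gt0 J0.
  rewrite -(leq_pmul2r Jr); apply: leq_trans sb.
  by rewrite -mulnA mulnC -mulnA leq_mul2l mulnC H1 orbT.
have tS x : {in S, forall A, t x A \in S}.
  move=> A /SP[trA kA]; rewrite !inE /t linearD /= trA add0r mxtrace_mulC krylov_comb_dual //.
  by rewrite mxtrace0 eqxx krylov_dim_update ?eqxx // krylov_comb_sub.
have tinj x : {in S &, injective (t x)}.
  move=> A A' /SP[_ kA] /SP[_ kA'] E.
  have ek : krylov A w j.+1 = krylov A' w j.+1.
    by rewrite -(krylov_update kA (krylov_comb A w j (val x)) (leqnn _)) -/(t x A) E krylov_update.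
  have ed : krylov_dual A w j = krylov_dual A' w j by rewrite /krylov_dual ek.
  have ec : krylov_comb A w j (val x) = krylov_comb A' w j (val x).
    apply: eq_bigr => i _; congr (_ *: _).
    by rewrite -(row_krylov A w (widen_ord (leqnSn j) i)) ek row_krylov.
  by move: E; rewrite /t ed ec => /addIr.
(* [translate_count] takes a whole number as bound, hence the quotient by [M], which is undone at
   once. *)
have H : (#|[set A in S | ~~ spectrum_ok A]| * #|{poly_j F}| <= 3 * q ^ j %/ M * #|S|)%N.
  by apply: (translate_count tS tinj) => A AS; rewrite leq_divRL // le.
rewrite card_npoly in H.
rewrite mulnAC; apply: leq_trans (leq_mul H (leqnn M)) _.
by rewrite mulnAC [leqRHS]mulnAC leq_mul2r leq_divM orbT.
Qed.

(** The classes of matrices of given Krylov dimension are disjoint, so the local bounds add up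
    without loss. *)
Lemma card_bad_spectrum (w : 'rV[F]_n) k0 : w != 0 ->
  (forall j, (k0 <= j.+1)%N -> (j < n)%N ->
     [/\ (J + D < j.+1)%N, (r * J < j.+1)%N, (c < j.+1)%N &
      [/\ (M * J ^ r <= (j.+1 - r * J) ^ r)%N,
       (M * (q ^ D * (J + D).+1 * q ^ (j.+1 - J.+2)) <= q ^ j)%N &
       (M * (n.+1 ^ 3 * q ^ (j.+1 - c).+1) <= q ^ j)%N]]) ->
  (#|[set A in sl F n | (k0 <= krylov_dim A w)%N && ~~ spectrum_ok A]| * M <=
   3 * #|sl F n|)%N.
Proof.
move=> nzw H.
pose Sj (j : 'I_n) := [set A in sl F n | krylov_dim A w == j.+1].
pose Bj (j : 'I_n) := if (k0 <= j.+1)%N then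
  [set A in sl F n | (krylov_dim A w == j.+1) && ~~ spectrum_ok A] else set0.
apply: (@leq_trans ((\sum_j #|Bj j|) * M)%N).
  rewrite leq_mul2r; apply/orP; right; apply: leq_card_bigcup => A.
  rewrite inE => /and3P[slA kA bA].
  have k1 := krylov_dim_gt0 A nzw; have kn := krylov_dim_le A w.
  have kn' : ((krylov_dim A w).-1 < n)%N by rewrite prednK.
  by exists (Ordinal kn'); rewrite /Bj /= prednK // kA inE slA eqxx bA.
apply: (@leq_trans (3 * \sum_j #|Sj j|)%N).
  rewrite big_distrl big_distrr /=; apply: leq_sum => j _; rewrite /Bj.
  case: ifP => kj; last by rewrite cards0.
  by have [? ? ? [? ? ?]] := H j kj (ltn_ord j); apply: card_bad_krylov.
rewrite leq_mul2l /=.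
under eq_bigr do rewrite -sum1dep_card.
rewrite (exchange_big_dep (mem (sl F n))) /=; last by move=> j A _ /andP[].
rewrite -sum1_card; apply: leq_sum => A slA.
rewrite sum1dep_card; apply/card_le1P => j; rewrite inE => /andP[_ /eqP kj] j'.
by rewrite [LHS]inE slA kj /= eqSS val_eqE eq_sym [RHS]inE.
Qed.
End BadMatrices.

Lemma card_set_pairs (S T : finType) (X : {set S}) (Y : {set T}) (Q : S -> T -> bool) :
  #|[set p in setX X Y | Q p.1 p.2]| = (\sum_(x in X) #|[set y in Y | Q x y]|)%N.
Proof.
rewrite -sum1_card; under [RHS]eq_bigr do rewrite -sum1_card.
rewrite pair_big_dep /=; apply: eq_bigl => -[x y] /=.
by rewrite !inE /= andbA.
Qed.

(** * The union of the bad events *)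

Section Final.
Variables (F : finFieldType) (K : closedFieldType) (fK : {rmorphism F -> K}) (n' : nat).
Local Notation n := n'.+1.
Local Notation q := #|F|.
Local Notation fr := (frob fK).
Variables (J D c r M m : nat).
Hypotheses (D3 : (2 < D)%N) (M0 : (0 < M)%N) (m0 : (0 < m)%N) (mn : (m < n)%N).
Hypotheses (Mn : (M * n <= q ^ m)%N) (MD : (M * q <= q ^ D)%N).

Let q0 : (0 < q)%N. Proof. exact: ltnW (finNzRing_gt1 F). Qed.

Lemma sl_lie_subalgebra : lie_subalgebra (sl F n).
Proof.
apply/and3P; split; first by rewrite inE mxtrace0.
  apply/forallP => a; apply/forall_inP => X; rewrite inE => /eqP tX.
  apply/forall_inP => Y; rewrite !inE => /eqP tY.
  by rewrite linearD linearZ /= tX tY mulr0 addr0.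
apply/forall_inP => X _; apply/forall_inP => Y _.
by rewrite inE linearB /= mxtrace_mulC subrr.
Qed.

Lemma lie_span_sl (A B : 'M[F]_n) : A \in sl F n -> B \in sl F n ->
  (forall L : {set 'M[F]_n}, lie_subalgebra L -> A \in L -> B \in L ->
     forall Z, \tr Z = 0 -> Z \in L) -> lie_span [set A; B] == sl F n.
Proof.
move=> slA slB gen; rewrite eqEsubset; apply/andP; split.
  apply: bigcap_inf; rewrite sl_lie_subalgebra /=; apply/subsetP => X.
  by rewrite in_set2 => /orP[] /eqP ->.
apply/bigcapsP => L /andP[lieL /subsetP AB]; apply/subsetP => Z; rewrite inE => /eqP tZ.
by apply: gen => //; apply: AB; rewrite !inE eqxx ?orbT.
Qed.

(** Nonzero vectors of a common invariant subspace of dimension at most [m] are of this kind, and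
    the two Krylov conditions are independent for random [A] and [B]. *)
Definition small_vector (A B : 'M[F]_n) : bool :=
  [exists f : 'rV[F]_n, [&& f != 0, (krylov_dim A f <= m)%N & (krylov_dim B f <= m)%N]].

Lemma card_krylov_small (w : 'rV[F]_n) : w != 0 ->
  (#|[set B in sl F n | krylov_dim B w <= n - m.+1]| * M <= #|sl F n|)%N.
Proof.
move=> nzw; have lt : (n - m.+1 < n)%N by clear -m0 mn; lia.
have := card_krylov_dim_le nzw lt.
have -> : (n - (n - m.+1).+1 = m)%N by clear -m0 mn; lia.
move=> H; rewrite -(leq_pmul2r (ltn0Sn n')) -mulnA.
apply: leq_trans (leq_mul (leqnn _) Mn) (leq_trans H _).
by rewrite mulnC leq_mul2l leq_subr orbT.
Qed.

Lemma card_sl_tr (Q : pred 'M[F]_n) :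
  #|[set B in sl F n | Q B^T]| = #|[set B in sl F n | Q B]|.
Proof.
rewrite -(card_imset _ (@trmx_inj _ _ _)); apply: eq_card => B.
apply/imsetP/idP => [[X + ->]|].
  by rewrite !inE mxtrace_tr.
by rewrite !inE => /andP[tB QB]; exists B^T; rewrite ?trmxK // !inE mxtrace_tr trmxK tB.
Qed.

(** The eigenvectors and their rational traces [wc], [wr] depend on [A] alone. So [B] only has to
    avoid three events about fixed vectors, each of relative size at most [1 / M]. *)
Lemma card_bad_partner (A : 'M[F]_n) : A \in sl F n -> spectrum_ok fK D A ->
  (#|[set B in sl F n | [&& ~~ small_vector A B, ~~ small_vector A^T B^T &
       lie_span [set A; B] != sl F n]]| * M <= 3 * #|sl F n|)%N.
Proof.
move=> slA /asboolP[lam [d [rs [Dd lam_d lam_inj chi [lam_rs lam1_rs iso]]]]].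
have d3 : (2 < d)%N by apply: leq_trans Dd.
have d0 : (0 < d)%N by apply: leq_trans d3.
rewrite map_char_poly in chi iso.
pose g := \prod_(r <- fr lam :: rs) ('X - r%:P).
have chiA : char_poly (map_mx fK A) = ('X - lam%:P) * g by rewrite chi big_cons.
have lam01 : lam != fr lam.
  by apply/eqP => /(@lam_inj 0 1 d0 (ltnW d3)).
have g_lam : ~~ root g lam by rewrite root_prod_XsubC inE (negPf lam01) (negPf lam_rs).
have [v [u [Av uA uv vd ud]]] := eigen_data lam_d chiA g_lam.
have [wc wcE] := frob_trace_descent d0 vd.
have [wr wrE] := frob_trace_descent d0 ud.
have [nzc nzr] := frob_trace_neq0 d0 lam_inj Av uA uv.
have nzwr : wr != 0 by apply: contraNneq nzr => w0; rewrite -wrE w0 map_mx0.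
have nzwc : wc^T != 0.
  apply: contraNneq nzc => w0; rewrite -wcE -[wc]trmxK w0 trmx0 map_mx0 //.
have nzu : u != 0.
  by apply: contra_eqN uv => /eqP ->; rewrite /pairing mul0mx mxE eq_sym oner_eq0.
have nzv : v != 0.
  by apply: contra_eqN uv => /eqP ->; rewrite /pairing mulmx0 mxE eq_sym oner_eq0.
have nzv1 : map_mx fr v != 0 by rewrite map_mx_eq0.
pose X1 := [set B in sl F n | (krylov_dim B wr <= n - m.+1)%N].
pose X2 := [set B in sl F n | (krylov_dim B^T wc^T <= n - m.+1)%N].
pose X3 := [set B in sl F n | pairing u (map_mx fK B *m map_mx fr v) == 0].
have cover : [set B in sl F n | [&& ~~ small_vector A B, ~~ small_vector A^T B^T &
       lie_span [set A; B] != sl F n]] \subset X1 :|: X2 :|: X3.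
  apply/subsetP => B; rewrite inE => /and4P[slB ns nsT ngen].
  apply: contraT; rewrite !in_setU !negb_or => /andP[/andP[n1 n2] n3].
  have k1 : (n - m <= krylov_dim B wr)%N.
    by move: n1; rewrite inE slB /= -ltnNge; clear -m0 mn; lia.
  have k2 : (n - m <= krylov_dim B^T wc^T)%N.
    by move: n2; rewrite inE slB /= -ltnNge; clear -m0 mn; lia.
  have nzB : pairing u (map_mx fK B *m map_mx fr v) != 0 by move: n3; rewrite inE slB.
  have irrow := @krylov_closure F n' A B wr m k1.
  have ircol := @krylov_closure_col F n' A B wc m k2.
  case/negP: ngen; apply: lie_span_sl => // L lieL AL BL Z tZ.
  apply: (@generate_sl F K fK n' A B lam d rs v u wc wr) => //.
  - move=> x s xr sr; apply: iso; by rewrite map_char_poly chi root_prod_XsubC.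
  - apply: ircol => f nzf k1' k2'; case/negP: ns; apply/existsP; exists f.
    by rewrite nzf k1' k2'.
  apply: irrow => f nzf k1' k2'; case/negP: nsT; apply/existsP; exists f.
  by rewrite nzf k1' k2'.
apply: leq_trans (leq_mul (subset_leq_card cover) (leqnn M)) _.
have cardU (Y Z : {set 'M[F]_n}) : (#|Y :|: Z| <= #|Y| + #|Z|)%N by rewrite cardsU leq_subr.
have leU : (#|X1 :|: X2 :|: X3| <= #|X1| + #|X2| + #|X3|)%N.
  by apply: leq_trans (cardU _ _) _; rewrite leq_add2r.
apply: leq_trans (leq_mul leU (leqnn M)) _.
rewrite !mulnDl (_ : 3 * #|sl F n| = #|sl F n| + #|sl F n| + #|sl F n|)%N; last first.
  by rewrite !mulSn addn0 addnA.
apply: leq_add; first apply: leq_add.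
- exact: card_krylov_small.
- rewrite /X2 (card_sl_tr (fun B => krylov_dim B wc^T <= n - m.+1)%N).
  exact: card_krylov_small.
have := card_pairing0 lam_inj uA nzu nzv1; rewrite -/X3 => H.
rewrite -(leq_pmul2r q0) -mulnA [leqRHS]mulnC.
apply: leq_trans H; rewrite leq_mul2l; apply/orP; right.
by apply: leq_trans MD _; rewrite leq_pexp2l.
Qed.

Hypothesis Msmall : (M * (q ^ n * m ^ 2) <= q ^ (2 * (n - m.+1)))%N.

(** A union over all [q ^ n] vectors is affordable since [A] and [B] must fail together: each does
    so with frequency about [q ^ (m - n)], and [Msmall] lets the square outweigh [q ^ n]. *)
Lemma card_small_vector :
  (#|[set p in setX (sl F n) (sl F n) | small_vector p.1 p.2]| * M <= #|sl F n| ^ 2)%N.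
Proof.
pose Xw (w : 'rV[F]_n) := [set A in sl F n | (krylov_dim A w <= m)%N].
pose Bw (w : 'rV[F]_n) := if w != 0 then setX (Xw w) (Xw w) else set0.
set Z := [set p in _ | _].
have le : (#|Z| <= \sum_w #|Bw w|)%N.
  apply: leq_card_bigcup => -[A B]; rewrite !inE /= => /andP[/andP[sA sB] /existsP[f /and3P[nzf kA kB]]].
  by exists f; rewrite /Bw nzf !inE /= sA sB kA kB.
have qm0 : (0 < q ^ n * m ^ 2)%N by rewrite muln_gt0 !expn_gt0 q0 m0.
rewrite -(leq_pmul2r qm0) -mulnA.
apply: leq_trans (leq_mul (leqnn _) Msmall) _.
apply: leq_trans (leq_mul le (leqnn _)) _.
rewrite big_distrl /=.
apply: (@leq_trans (\sum_(w : 'rV[F]_n) (m * #|sl F n|) ^ 2)%N).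
  apply: leq_sum => w _; rewrite /Bw; case: ifP => [nzw|_]; last by rewrite cards0.
  rewrite cardsX mulnn [(2 * _)%N]mulnC expnM -expnMn; apply: leq_exp_base.
  exact: card_krylov_dim_le.
by rewrite sum_nat_const card_mx mul1n expnMn mulnA mulnC.
Qed.

Lemma card_small_vector_tr :
  (#|[set p in setX (sl F n) (sl F n) | small_vector p.1^T p.2^T]| * M <= #|sl F n| ^ 2)%N.
Proof.
apply: leq_trans card_small_vector; rewrite leq_mul2r; apply/orP; right.
have inj : injective (fun p : 'M[F]_n * 'M[F]_n => (p.1^T, p.2^T)).
  by move=> [A B] [A' B'] [/trmx_inj -> /trmx_inj ->].
rewrite -(card_imset _ inj); apply/subset_leq_card/subsetP => _ /imsetP[[A B] + ->].
by rewrite !inE /= !mxtrace_tr.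
Qed.

Hypotheses (oddq : odd q) (c0 : (0 < c)%N) (cD : (5 * c <= D)%N) (J0 : (0 < J)%N).
Hypothesis numeric : forall j, (n - m <= j.+1)%N -> (j < n)%N ->
     [/\ (J + D < j.+1)%N, (r * J < j.+1)%N, (c < j.+1)%N &
      [/\ (M * J ^ r <= (j.+1 - r * J) ^ r)%N,
       (M * (q ^ D * (J + D).+1 * q ^ (j.+1 - J.+2)) <= q ^ j)%N &
       (M * (n.+1 ^ 3 * q ^ (j.+1 - c).+1) <= q ^ j)%N]].

Lemma card_not_generating :
  (#|[set p in setX (sl F n) (sl F n) | lie_span [set p.1; p.2] != sl F n]| * M
    <= 9 * #|sl F n| ^ 2)%N.
Proof.
(* Any fixed nonzero vector would do; a large Krylov space of [A] at it leaves room for the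
   translations of the characteristic polynomial. *)
pose e0 : 'rV[F]_n := delta_mx 0 0.
have nze0 : e0 != 0.
  by apply/eqP => /rowP/(_ 0)/eqP; rewrite !mxE !eqxx oner_eq0.
pose Z1 := [set p in setX (sl F n) (sl F n) | small_vector p.1 p.2].
pose Z2 := [set p in setX (sl F n) (sl F n) | small_vector p.1^T p.2^T].
pose Y3 := [set A in sl F n | (krylov_dim A e0 <= n - m.+1)%N].
pose Z3 := setX Y3 (sl F n).
pose Y4 := [set A in sl F n | (n - m <= krylov_dim A e0)%N && ~~ spectrum_ok fK D A].
pose Z4 := setX Y4 (sl F n).
pose Q (A B : 'M[F]_n) := spectrum_ok fK D A && [&& ~~ small_vector A B,
   ~~ small_vector A^T B^T & lie_span [set A; B] != sl F n].
pose Z5 := [set p in setX (sl F n) (sl F n) | Q p.1 p.2].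
have cover : [set p in setX (sl F n) (sl F n) | lie_span [set p.1; p.2] != sl F n]
    \subset Z1 :|: Z2 :|: Z3 :|: Z4 :|: Z5.
  apply/subsetP => -[A B]; rewrite inE /= => /andP[slAB ng].
  have /setXP[/= slA slB] := slAB.
  rewrite !in_setU !in_setX.
  have -> : ((A, B) \in Z1) = small_vector A B by rewrite inE slAB.
  have -> : ((A, B) \in Z2) = small_vector A^T B^T by rewrite inE slAB.
  have -> : ((A, B) \in Z5) = Q A B by rewrite inE slAB.
  rewrite slB !andbT /= [A \in Y3]inE [A \in Y4]inE slA /=.
  rewrite /Q ng andbT; case: (small_vector A B) => //=.
  case: (small_vector A^T B^T) => //=; rewrite andbT.
  case: (spectrum_ok fK D A); rewrite ?orbT //= andbT orbF.
  by clear -m0 mn; lia.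
have cardU (Y Z : {set 'M[F]_n * 'M[F]_n}) : (#|Y :|: Z| <= #|Y| + #|Z|)%N.
  by rewrite cardsU leq_subr.
have leU : (#|Z1 :|: Z2 :|: Z3 :|: Z4 :|: Z5| <= #|Z1| + #|Z2| + #|Z3| + #|Z4| + #|Z5|)%N.
  do 3 (apply: leq_trans (cardU _ _) _; rewrite leq_add2r).
  exact: cardU.
apply: leq_trans (leq_mul (leq_trans (subset_leq_card cover) leU) (leqnn M)) _.
rewrite !mulnDl; set s2 := (#|sl F n| ^ 2)%N.
(* The weights of [Z1] to [Z5]. *)
have -> : (9 * s2 = s2 + s2 + s2 + 3 * s2 + 3 * s2)%N by clear; lia.
apply: leq_add; first apply: leq_add; first apply: leq_add; first apply: leq_add.
- exact: card_small_vector.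
- exact: card_small_vector_tr.
- rewrite cardsX mulnAC /s2 -mulnn leq_mul2r; apply/orP; right; exact: card_krylov_small.
- rewrite cardsX mulnAC /s2 -mulnn mulnA leq_mul2r; apply/orP; right.
  exact: (card_bad_spectrum fK oddq c0 cD J0 M0 nze0 numeric).
rewrite card_set_pairs big_distrl /=.
apply: (@leq_trans (\sum_(A in sl F n) 3 * #|sl F n|)%N); last first.
  by rewrite sum_nat_const mulnCA mulnn.
apply: leq_sum => A slA; rewrite /Q; case: (boolP (spectrum_ok fK D A)) => okA /=.
  exact: card_bad_partner.
rewrite (_ : [set B in sl F n | false] = set0) ?cards0 //.
by apply/setP => B; rewrite !inE andbF.
Qed.
End Final.

(** * Numerical estimates *)

Lemma eventually_poly_le_exp2 e : exists S, forall s, (S <= s)%N ->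
  (9 * s.+1 ^ e <= 2 ^ (s %/ 10 - 2))%N.
Proof.
(* With [u = s %/ b] one has [s.+1 <= 2 ^ (2 * u)], so the left side is at most
   [2 ^ (4 + 2 * u * e)], while [b] is chosen to make [s %/ 10] at least [2 * u * (e + 8)]. *)
pose b := (20 * (e + 8))%N; exists (b * b)%N => s bs.
pose u := (s %/ b)%N.
have b0 : (0 < b)%N by rewrite /b; lia.
have bu : (b <= u)%N by rewrite leq_divRL.
have us : (u * b <= s)%N by apply: leq_divM.
have su : (s < u.+1 * b)%N by apply: ltn_ceil.
have u2 : (u.+1 <= 2 ^ u)%N by apply: ltn_expl.
have s2 : (s.+1 <= 2 ^ (2 * u))%N.
  rewrite mul2n -addnn expnD; apply: leq_trans su _; apply: leq_mul => //.
  exact: leq_trans bu (ltnW u2).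
apply: (@leq_trans (2 ^ 4 * (2 ^ (2 * u)) ^ e)%N).
  by apply: leq_mul => //; apply: leq_exp_base.
rewrite -expnM -expnD leq_exp2l // leq_subRL; last first.
  rewrite leq_divRL //; move: us bu; rewrite /b; clear; nia.
have : (u * (2 * (e + 8)) <= s %/ 10)%N.
  by rewrite leq_divRL //; move: us; rewrite /b; clear; nia.
move: (leq_trans b0 bu); clear; nia.
Qed.

Lemma exists_sqrt n : exists s, (s ^ 2 <= n < s.+1 ^ 2)%N.
Proof.
have ex : exists s, (n < s.+1 ^ 2)%N by exists n; nia.
case: (ex_minnP ex) => -[|s] sP smin; first by exists 0%N.
exists s.+1; rewrite sP andbT leqNgt; apply/negP => /smin; by rewrite ltnn.
Qed.

Section Numerics.
Variables (g n s q : nat).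
Hypotheses (sn : (s ^ 2 <= n < s.+1 ^ 2)%N) (q2 : (2 <= q)%N).
Hypothesis s_smooth : (18 * 16 ^ g <= s)%N.
Hypothesis s_big : (12 * g + 100 <= s)%N.
Hypothesis s_exp : (9 * s.+1 ^ (2 * g + 6) <= 2 ^ (s %/ 10 - 2))%N.

(** Here [J = s]. The power smooth fraction is at most [(2 / s) ^ r], and [n <= 4 * s ^ 2] brings it
    below [1 / M] for [r = 2 * g + 1] once [s >= 18 * 16 ^ g]. The gap between [D] and [J] absorbs
    the [q ^ D] choices of a small factor, [5 * c <= D] permits the rotation, and [m] is well below
    [n / 2] for the sake of common small vectors. The 9 in [M] cancels the total weight of the bad
    events. *)
Local Notation M := (9 * n ^ g)%N.
Local Notation r := (2 * g + 1)%N.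
Local Notation D := (s %/ 2)%N.
Local Notation c := (s %/ 10)%N.
Local Notation m := (n %/ 3)%N.

Let s2n : (s * s <= n)%N. Proof. by case/andP: sn; rewrite mulnn. Qed.
Let s100 : (100 <= s)%N. Proof. by move: s_big; clear; lia. Qed.
Let n100 : (100 * s <= n)%N. Proof. by move: s2n s100; clear; nia. Qed.
Let c10 : (10 <= c)%N. Proof. by move: s100; clear; lia. Qed.

Lemma numeric_key : (M * n.+1 ^ 3 <= q ^ (c - 2))%N.
Proof.
apply: (@leq_trans (2 ^ (c - 2))); last exact: leq_exp_base.
apply: leq_trans s_exp; rewrite -mulnA leq_mul2l /=.
have n1 : (n.+1 <= s.+1 ^ 2)%N by case/andP: sn.
apply: (@leq_trans (n.+1 ^ (g + 3))%N).
  by rewrite expnD leq_mul2r leq_exp_base ?orbT.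
have -> : (2 * g + 6 = 2 * (g + 3))%N by lia.
by rewrite expnM leq_exp_base.
Qed.

Let key1 a : (a <= n.+1 ^ 3)%N -> (M * a <= q ^ (c - 2))%N.
Proof. by move=> an; apply: leq_trans numeric_key; rewrite leq_mul2l an orbT. Qed.

Let q0 : (0 < q)%N. Proof. exact: ltnW. Qed.
Let lepow a b : (a <= b)%N -> (q ^ a <= q ^ b)%N. Proof. by apply: leq_pexp2l. Qed.

Lemma numeric_Mn : (M * n <= q ^ m)%N.
Proof.
apply: (@leq_trans (q ^ (c - 2))%N); first by apply: key1; rewrite !expnS; clear; nia.
by apply: lepow; move: n100; clear; lia.
Qed.

Lemma numeric_MD : (M * q <= q ^ D)%N.
Proof.
apply: (@leq_trans (q ^ (c - 2) * q)%N).
  by rewrite leq_mul2r; apply/orP; right; rewrite -[leqLHS]muln1; apply: key1; rewrite expn_gt0.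
by rewrite -expnSr; apply: lepow; move: s100; clear; lia.
Qed.

Lemma numeric_small : (M * (q ^ n * m ^ 2) <= q ^ (2 * (n - m.+1)))%N.
Proof.
rewrite mulnCA mulnC; apply: (@leq_trans (q ^ (c - 2) * q ^ n)%N).
  rewrite leq_mul2r; apply/orP; right; apply: key1.
  apply: (@leq_trans (n.+1 ^ 2)%N); last by rewrite leq_pexp2l.
  by apply: leq_exp_base; apply: leq_trans (leqnSn n); apply: leq_div.
by rewrite -expnD; apply: lepow; move: n100 s100; clear; lia.
Qed.

Lemma numeric_smooth j : (n - m <= j.+1)%N -> (M * s ^ r <= (j.+1 - r * s) ^ r)%N.
Proof.
move=> jn; set X := (j.+1 - r * s)%N.
have rs : (6 * (r * s) <= n)%N by move: s2n s_big; clear; nia.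
have X2 : (s * s <= 2 * X)%N.
  by apply: leq_trans s2n _; rewrite /X; move: rs jn s100 n100; clear; lia.
have p2 : (0 < 2 ^ r)%N by rewrite expn_gt0.
rewrite -(leq_pmul2l p2) -expnMn; apply: (@leq_trans ((s * s) ^ r)); last exact: leq_exp_base.
rewrite expnMn mulnA leq_mul2r; apply/orP; right.
have n4 : (n <= 4 * s ^ 2)%N by case/andP: sn => _; move: s100; rewrite -!mulnn; clear; nia.
apply: (@leq_trans (2 ^ r * (9 * (4 * s ^ 2) ^ g))%N).
  by rewrite !leq_mul2l leq_exp_base ?orbT.
rewrite expnMn -expnM [(2 * g + 1)%N]addn1 !expnS.
apply: leq_trans (leq_mul s_smooth (leqnn _)).
rewrite !mulnA leq_mul2r; apply/orP; right.
rewrite [(16 ^ g)%N](_ : _ = 2 ^ (2 * g) * 4 ^ g)%N; last by rewrite expnM -expnMn.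
by clear; nia.
Qed.

Lemma numeric_all j : (n - m <= j.+1)%N -> (j < n)%N ->
  [/\ (s + D < j.+1)%N, (r * s < j.+1)%N, (c < j.+1)%N &
   [/\ (M * s ^ r <= (j.+1 - r * s) ^ r)%N,
       (M * (q ^ D * (s + D).+1 * q ^ (j.+1 - s.+2)) <= q ^ j)%N &
       (M * (n.+1 ^ 3 * q ^ (j.+1 - c).+1) <= q ^ j)%N]].
Proof.
move=> jn jn'; have rs : (6 * (r * s) <= n)%N by move: s2n s_big; clear; nia.
have sj : (s + D + 50 < j.+1)%N by move: jn n100 s100; clear; lia.
split; [by move: sj; clear; lia|by move: rs jn n100 s100; clear; lia|by move: sj; clear; lia|].
split; first exact: numeric_smooth.
  apply: (@leq_trans (q ^ (c - 2) * (q ^ D * q ^ (j.+1 - s.+2)))%N).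
    rewrite [(q ^ D * _)%N]mulnC -[(_ * q ^ D * _)%N]mulnA mulnA leq_mul2r; apply/orP; right.
    apply: key1; apply: (@leq_trans (n.+1 ^ 1)%N); last by rewrite leq_pexp2l.
    by rewrite expn1 ltnS; move: n100 s100; clear; lia.
  by rewrite -!expnD; apply: lepow; move: sj s100; clear; lia.
rewrite mulnA; apply: leq_trans (leq_mul numeric_key (leqnn _)) _.
by rewrite -expnD; apply: lepow; move: sj c10; clear; lia.
Qed.
End Numerics.

Lemma card_not_generating_bound g : exists n0, forall n, (n0 <= n)%N ->
  forall F : finFieldType, odd #|F| ->
  (#|[set p in setX (sl F n) (sl F n) | lie_span [set p.1; p.2] != sl F n]| * n ^ g
    <= #|sl F n| ^ 2)%N.
Proof.
have [S SP] := eventually_poly_le_exp2 (2 * g + 6).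
pose s0 := maxn S (maxn (18 * 16 ^ g) (12 * g + 100)).
exists (s0.+1 ^ 2)%N => n n0 F oddq.
have [s sn] := exists_sqrt n.
have s0s : (s0 <= s)%N.
  rewrite leqNgt; apply/negP => ss0; move: n0; apply/negP; rewrite -ltnNge.
  by case/andP: sn => _ h; apply: leq_trans h _; apply: leq_exp_base; apply: leqW.
have sS : (S <= s)%N by apply: leq_trans s0s; rewrite leq_maxl.
have s1 : (18 * 16 ^ g <= s)%N by apply: leq_trans s0s; rewrite leq_max leq_maxl orbT.
have s2 : (12 * g + 100 <= s)%N by apply: leq_trans s0s; rewrite leq_max leq_maxr orbT.
have q2 : (2 <= #|F|)%N := finNzRing_gt1 F.
have [K [fK _]] := countable_algebraic_closure F.
have ss : (s * s <= n)%N by case/andP: sn; rewrite mulnn.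
case: n n0 sn ss => [|n'] n0 sn ss; first by move: s2 ss; clear; nia.
have key := @card_not_generating F K fK n' s (s %/ 2) (s %/ 10) (2 * g + 1) (9 * n'.+1 ^ g) (n'.+1 %/ 3).
rewrite -(leq_pmul2l (isT : (0 < 9)%N)) mulnCA.
apply: key => //.
- by move: s2; clear; lia.
- by rewrite muln_gt0 expn_gt0.
- by move: ss s2; clear; nia.
- by move: ss s2; clear; nia.
- by apply: (numeric_Mn sn) => //; apply: SP.
- by apply: (numeric_MD sn) => //; apply: SP.
- by apply: (numeric_small sn) => //; apply: SP.
- by move: s2; clear; lia.
- by clear; lia.
- by move: s2; clear; lia.
by move=> j jn jn'; apply: (numeric_all sn) => //; apply: SP.
Qed.

Theorem theorem8p5 (R : realType) (gamma : R) (gamma_gt0 : 0 < gamma) :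
  exists n0 : nat, (0 < n0)%N /\
    forall n : nat, (n0 <= n)%N ->
    forall F : finFieldType, odd #|F| ->
      1 - n%:R `^ (- gamma) <= prob_generate_sl R F n.
Proof.
pose g := Num.bound gamma.
have gammag : gamma <= g%:R by apply: ltW; apply: archi_boundP; exact: ltW.
have [n1 n1P] := card_not_generating_bound g.
exists n1.+1; split=> // n nn F oddF.
have n0 : (0 < n)%N by apply: leq_trans nn.
have {n1P}H := n1P n (ltnW nn) F oddF.
rewrite /prob_generate_sl /uniform_prob; set Om := setX _ _ in H *.
set bad := [set p in Om | _] in H; set good := [set w in Om | _].
have OmE : #|Om| = (#|sl F n| ^ 2)%N by rewrite cardsX mulnn.
have Om0 : (0 < #|Om|)%N.
  rewrite OmE expn_gt0; apply/orP; left; apply/card_gt0P; exists 0.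
  by rewrite inE mxtrace0.
have gb : (#|good| + #|bad| = #|Om|)%N.
  rewrite -(cardsID [set p | lie_span [set p.1; p.2] == sl F n] Om).
  congr (_ + _)%N; apply: eq_card => p; rewrite /good /bad ?in_setI ?in_setD !in_set //.
  by rewrite andbC.
have OmR : 0 < #|Om|%:R :> R by rewrite ltr0n.
have ng0 : 0 < (n%:R : R) ^+ g by rewrite exprn_gt0 // ltr0n.
have -> : #|good|%:R = #|Om|%:R - #|bad|%:R :> R by rewrite -gb natrD addrK.
rewrite mulrBl divff ?gt_eqF // lerD2l lerN2.
apply: (@le_trans _ _ ((n%:R : R) ^+ g)^-1).
  rewrite ler_pdivrMr // mulrC ler_pdivlMr // -natrX -natrM ler_nat OmE.
  exact: H.
rewrite -powR_mulrn ?ler0n // -powRN; apply: ler_powR; first by rewrite ler1n.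
by rewrite lerN2.
Qed.
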